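(* Let $\mathcal{S}\subset\mathcal{D}$ be a sparse collection of dyadic cubes in $\mathbb{R}^n$ with Carleson constant $\Lambda>1$, let $1<p<\infty$, let $\mu,\lambda\in A_p^{\mathcal{D}}$ be two weights on $\mathbb{R}^n$, and let $\nu:=\mu^{1/p}\lambda^{-1/p}$. Then the Bloom sparse operator $$\mathcal{A}_{\mathcal{S}}^\nu f:=\sum_{Q\in\mathcal{S}}\langle\nu\rangle_Q\langle f\rangle_Q\mathbf{1}_Q$$ is bounded $L^p(\mu)\to L^p(\lambda)$ with $$\|\mathcal{A}_{\mathcal{S}}^\nu:L^p(\mu)\to L^p(\lambda)\|\le\Lambda^{p'+p-2}\,(pp')\,[\mu']_{A_{p'}}[\lambda]_{A_p}=\Lambda^{p'+p-2}\,(pp')\,[\mu]_{A_p}^{\frac1{p-1}}[\lambda]_{A_p}.$$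
   Context: $\mathcal{D}$ is a fixed dyadic grid on $\mathbb{R}^n$: a collection of cubes with side lengths $2^k$, $k\in\mathbb{Z}$, such that for each fixed $k$ the cubes of side length $2^k$ partition $\mathbb{R}^n$, and $P\cap Q\in\{P,Q,\emptyset\}$ for all $P,Q\in\mathcal{D}$. $\mathcal{S}\subset\mathcal{D}$ has Carleson constant $\Lambda>1$ (is $\Lambda$-Carleson) if $\sum_{P\in\mathcal{S},P\subset Q}|P|\le\Lambda|Q|$ for all $Q\in\mathcal{D}$; it is sparse if it is $\Lambda$-Carleson for some $\Lambda>1$ (equivalently, for some $\eta\in(0,1)$ there are pairwise disjoint measurable sets $E_Q\subset Q$, $Q\in\mathcal{S}$, with $|E_Q|\ge\eta|Q|$; one may take $\eta=1/\Lambda$). A weight is a locally integrable, a.e. positive function; $\langle f\rangle_Q=\frac1{|Q|}\int_Qf\,dx$; $L^p(w)$ is $L^p$ of the measure $w\,dx$. With $1/p+1/p'=1$, the conjugate weight is $w'=w^{1-p'}$, and $w\in A_p^{\mathcal{D}}$ means $[w]_{A_p}:=\sup_{Q\in\mathcal{D}}\langle w\rangle_Q\langle w'\rangle_Q^{p-1}<\infty$; one has $[w']_{A_{p'}}=[w]_{A_p}^{1/(p-1)}$. $\|T:X\to Y\|$ is the operator norm. *)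

(* Defs.v *)
From HB Require Import structures.
From mathcomp Require Import all_boot all_order all_algebra.
From mathcomp Require Import all_classical all_reals all_analysis.
From mathcomp Require Import measurable_realfun.
Set Implicit Arguments.
Unset Strict Implicit.
Unset Printing Implicit Defensive.
Import Order.TTheory GRing.Theory Num.Theory.
Import numFieldNormedType.Exports.
Local Open Scope classical_set_scope.
Local Open Scope ring_scope.

(* Lebesgue measure on the Borel sets of R^n (the product sigma-algebra that
   the library puts on n.-tuple R), by iterating the binary product measure. *)
Section lebesgue_step.
Context {R : realType} (n : nat).
Variable m : {sigma_finite_measure set (n.-tuple R) -> \bar R}.

Definition tuple_cons (z : measurableTypeR R * n.-tuple R) : n.+1.-tuple R :=
  [the n.+1.-tuple R of z.1 :: z.2].

Lemma measurable_tuple_cons : measurable_fun setT tuple_cons.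
Proof. by apply: measurable_cons. Qed.

Definition lebesgue_step : set (n.+1.-tuple R) -> \bar R :=
  pushforward (@lebesgue_measure R \x m)%E tuple_cons.

Let lebesgue_step0 : lebesgue_step set0 = 0%E.
Proof. by rewrite /lebesgue_step /pushforward preimage_set0 measure0. Qed.

Let lebesgue_step_ge0 A : (0 <= lebesgue_step A)%E.
Proof. by rewrite /lebesgue_step /pushforward measure_ge0. Qed.

Let lebesgue_step_sigma_additive : semi_sigma_additive lebesgue_step.
Proof.
move=> F mF tF mUF; rewrite /lebesgue_step /pushforward preimage_bigcup.
apply: measure_semi_sigma_additive.
- by move=> k; rewrite -[X in measurable X]setTI; exact: measurable_tuple_cons.
- apply/trivIsetP => /= i j _ _ ij; rewrite -preimage_setI.
  by move/trivIsetP : tF => /(_ _ _ _ _ ij) ->//; rewrite preimage_set0.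
- rewrite -preimage_bigcup -[X in measurable X]setTI.
  exact: measurable_tuple_cons.
Qed.

HB.instance Definition _ := isMeasure.Build _ _ _ lebesgue_step
  lebesgue_step0 lebesgue_step_ge0 lebesgue_step_sigma_additive.

Let lebesgue_step_sigma_finite : sigma_finite setT lebesgue_step.
Proof.
have /sigma_finiteP[F [TF ndF Foo]] := sigma_finiteT (@lebesgue_measure R).
have /sigma_finiteP[G [TG ndG Goo]] := sigma_finiteT m.
pose g (t : n.+1.-tuple R) : measurableTypeR R * n.-tuple R :=
  (thead t, [tuple of behead t]).
have mg : measurable_fun setT g.
  apply/measurable_fun_pairP; split => /=.
    exact: measurable_tnth.
  exact: measurable_behead.
exists (fun k => g @^-1` (F k `*` G k)).
  rewrite -preimage_bigcup; apply/seteqP; split => // t _.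
  have [i _ Fi] : (\bigcup_i F i) (g t).1 by rewrite -TF.
  have [j _ Gj] : (\bigcup_i G i) (g t).2 by rewrite -TG.
  exists (maxn i j) => //; split.
  - by move: Fi; exact/subsetPset/ndF/leq_maxl.
  - by move: Gj; exact/subsetPset/ndG/leq_maxr.
move=> k; have [mF Fkoo] := Foo k; have [mG Gkoo] := Goo k; split.
  by rewrite -[X in measurable X]setTI; apply: mg => //; exact: measurableX.
rewrite /lebesgue_step /pushforward -comp_preimage.
rewrite (_ : g \o tuple_cons = id) ?preimage_id; last first.
  apply/funext => -[a t] /=; rewrite /g /tuple_cons/= theadE; congr pair.
  exact: val_inj.
by rewrite product_measure1E// lte_mul_pinfty// ge0_fin_numE.
Qed.

HB.instance Definition _ := @Measure_isSigmaFinite.Build _ _ _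
  lebesgue_step lebesgue_step_sigma_finite.

End lebesgue_step.

Fixpoint borel_lebesgue (R : realType) (n : nat) :
    {sigma_finite_measure set (n.-tuple R) -> \bar R} :=
  if n is n'.+1 then lebesgue_step (borel_lebesgue R n')
  else \d_([tuple] : 0.-tuple R).

(* R^n with the sigma-algebra of Lebesgue measurable sets, that is, the
   Caratheodory-measurable sets of the outer measure of borel_lebesgue. *)
Definition Rn (R : realType) (n : nat) :=
  caratheodory_type ((borel_lebesgue R n)^*)%mu.

HB.instance Definition _ R n := Measurable.on (Rn R n).

Definition lebesgue (R : realType) (n : nat) : set (Rn R n) -> \bar R :=
  @completed_measure_extension _ _ _ (borel_lebesgue R n).
Arguments lebesgue {R n}.

HB.instance Definition _ R n := Measure.on (@lebesgue R n).

Definition coord (R : realType) (n : nat) (x : Rn R n) (i : 'I_n) : R :=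
  tnth (x : n.-tuple R) i.

Section weights.
Context {R : realType} {n : nat}.
Local Notation T := (Rn R n).
Local Open Scope ereal_scope.

(* The topology of R^n is the one of row vectors. *)
Definition locally_integrable_Rn (f : T -> R) :=
  measurable_fun setT f /\
  forall K : set 'rV[R]_n, compact K ->
    lebesgue.-integrable [set x : T | K (\row_i coord x i)] (EFin \o f).

Record weight := Weight {
  weight_fun :> T -> R ;
  weight_locint : locally_integrable_Rn weight_fun ;
  weight_gt0 : {ae lebesgue, forall x, (0 < weight_fun x)%R} }.

(* the measure w dx *)
Definition wmeasure (w : weight) (A : set T) : \bar R :=
  \int[lebesgue]_(x in A) (w x)%:E.

Section wmeasure.
Variable w : weight.

Let mw : measurable_fun setT (fun x => (w x)%:E).
Proof. by apply/measurable_EFinP; have [] := weight_locint w. Qed.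

Let wmeasure_neg0 A : \int[lebesgue]_(x in A) (EFin \o w)^\- x = 0.
Proof.
apply/eqP; rewrite eq_le integral_ge0 ?andbT//.
have <- : \int[@lebesgue R n]_x (EFin \o w)^\- x = 0.
  rewrite -[RHS](@integral0 _ _ _ (@lebesgue R n) setT).
  apply: ae_eq_integral => //; first exact: measurable_funeneg.
  have := weight_gt0 w; apply: filterS => x wx _.
  by rewrite funenegE /= max_r //= lee_fin lerNl oppr0 ltW.
rewrite ge0_integralE// ge0_integralTE//.
apply: le_ereal_sup => _ [h hw <-]; exists h => // x.
apply: (le_trans (hw x)); rewrite patchE; case: ifPn => // _.
by rewrite funenegE le_max lexx orbT.
Qed.

Let wmeasureE A : wmeasure w A = \int[lebesgue]_(x in A) (EFin \o w)^\+ x.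
Proof. by rewrite /wmeasure integralE wmeasure_neg0 sube0. Qed.

Let wmeasure0 : wmeasure w set0 = 0.
Proof. exact: integral_set0. Qed.

Let wmeasure_ge0 A : 0 <= wmeasure w A.
Proof. by rewrite wmeasureE integral_ge0. Qed.

Let wmeasure_sigma_additive : semi_sigma_additive (wmeasure w).
Proof.
rewrite (_ : wmeasure w = fun A => \int[lebesgue]_(x in A) (EFin \o w)^\+ x).
  by apply: semi_sigma_additive_nng_induced => //; exact: measurable_funepos.
by apply/funext => A; exact: wmeasureE.
Qed.

HB.instance Definition _ := isMeasure.Build _ _ _ (wmeasure w)
  wmeasure0 wmeasure_ge0 wmeasure_sigma_additive.

End wmeasure.
End weights.
Arguments weight R n : clear implicits.

Section dyadic.
Context {R : realType} {n : nat}.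
Local Notation T := (Rn R n).
Implicit Types (D S : set (set T)) (Q : set T).

(* A product of n intervals of length l; each of the bounds of each interval
   may be open or closed, so that [a, a + l[ and ]a, a + l] are both allowed. *)
Definition is_cube (l : R) Q :=
  exists (a : 'I_n -> R) (b c : 'I_n -> bool),
    Q = [set x | forall i,
      coord x i \in Interval (BSide (b i) (a i)) (BSide (c i) (a i + l))].

Definition dyadic_grid D :=
  [/\ forall Q, D Q -> exists k : int, is_cube (2 ^ k) Q,
      forall k : int, partition [set Q | D Q /\ is_cube (2 ^ k) Q] id setT
    & forall P Q, D P -> D Q -> P `&` Q = P \/ P `&` Q = Q \/ P `&` Q = set0].

Definition Carleson D S (Lam : R) :=
  forall Q, D Q ->
    (\esum_(P in [set P | S P /\ P `<=` Q]) lebesgue P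
       <= Lam%:E * lebesgue Q)%E.

(* <f>_Q, extended-real valued so that it is +oo for f >= 0 not integrable
   on Q *)
Definition average (f : T -> R) Q : \bar R :=
  ((fine (lebesgue Q))^-1%:E * \int[lebesgue]_(x in Q) (f x)%:E)%E.

Definition conj_exp (p : R) : R := fine (hoelder_conjugate p%:E).

Definition conj_weight (p : R) (w : T -> R) : T -> R :=
  fun x => w x `^ (1 - conj_exp p).

Definition Ap_const D (p : R) (w : T -> R) : \bar R :=
  ereal_sup
    [set (average w Q * average (conj_weight p w) Q `^ (p - 1))%E | Q in D].

Definition Ap D (p : R) (w : weight R n) := (Ap_const D p w < +oo)%E.

Definition bloom_weight (p : R) (mu lam : T -> R) : T -> R :=
  fun x => mu x `^ p^-1 * lam x `^ (- p^-1).

Definition bloom_term (nu f : T -> R) (x : T) Q : \bar R :=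
  (fine (average nu Q) * fine (average f Q) * \1_Q x)%:E.

(* The sum over S of the terms, as the sum of the positive parts minus the sum
   of the negative parts; it is the sum of the family when the latter is
   summable. *)
Definition bloom_sparse S (nu f : T -> R) : T -> R := fun x =>
  fine (\esum_(Q in S) (bloom_term nu f x)^\+ Q
        - \esum_(Q in S) (bloom_term nu f x)^\- Q)%E.

Definition opnorm (m1 m2 : {measure set T -> \bar R}) (p : \bar R)
    (A : (T -> R) -> (T -> R)) : \bar R :=
  ereal_sup [set ('N[m2]_p[EFin \o A f])%E |
    f in [set f | f \in Lfun m1 p /\ ('N[m1]_p[EFin \o f] <= 1)%E]].

End dyadic.

(* Main.v *)
Require Import Defs.
From HB Require Import structures.
From mathcomp Require Import all_boot all_order all_algebra.
From mathcomp Require Import all_classical all_reals all_analysis.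
From mathcomp Require Import measurable_realfun.
From mathcomp Require Import ring lra.
Import Order.TTheory GRing.Theory Num.Theory.
Import numFieldNormedType.Exports.
Local Open Scope classical_set_scope.
Local Open Scope ring_scope.

Set Implicit Arguments.
Unset Strict Implicit.
Unset Printing Implicit Defensive.

(** Both [mu] and [lam] may be taken positive everywhere and [f] nonnegative.
    Put [q = p / (p - 1)], [sigma = mu `^ (1 - q)], [K1] for the constant of
    [sigma] in its class of exponent [q] and [K2] for the constant of [lam].

    For a finite subfamily with sum [G], duality is replaced by testing against
    [h = G `^ (p - 1) * lam]: the integral [X] of [G `^ p * lam] is the sum over
    the cubes [Q] of [|Q| <nu>_Q <f>_Q <h>_Q].  Let [a_Q] be the quotient of the
    integrals of [f] and [sigma] over [Q], and [b_Q] that of the integrals of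
    [h] and [lam].  Hoelder's inequality bounds [<nu>_Q] by
    [<mu>_Q `^ p^-1 * <lam `^ (1 - q)>_Q `^ q^-1], and the two weight conditions
    then bound the term of [Q] by [K1 `^ q^-1 * K2 `^ p^-1] times
    [(sigma(Q) `^ p^-1 * a_Q) * (lam(Q) `^ q^-1 * b_Q)] ([two_weight_term]).
    Hoelder's inequality for sums leaves two sums, of [sigma(Q) * a_Q `^ p] and
    of [lam(Q) * b_Q `^ q], and each is controlled by a Carleson embedding
    ([carleson_embedding]): by
    [K1 * Lam `^ q * q `^ p] times the integral of [f `^ p * mu], and by
    [K2 * Lam `^ p * p `^ q * X].  Since [q / p = q - 1] and [p / q = p - 1],
    this reads [X <= C * N(f) * X `^ q^-1] with [C] the constant of the theorem
    and [N(f)] the norm of [f], and [X] is finite, so that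
    [X <= (C * N(f)) `^ p] ([finite_sparse_bound]).

    The embedding has two ingredients.  The Carleson condition yields functions
    [phi_Q] between [0] and the indicator of [Q], of total at most [1], with
    integral [|Q| / Lam] ([carleson_fractions]); the weight condition upgrades
    this to [w(Q) <= K * Lam `^ q * w(phi_Q)].  The sum of [w(Q) * a_Q `^ p] is
    then at most [K * Lam `^ q] times the integral of [M `^ p * w], where [M] is
    the maximal function of the family, and Doob's inequality ([maximal_bound])
    bounds that integral with the constant [q `^ p].

    A grid is countable because every cube contains a rational point, and the
    bounds on finite subfamilies pass to the whole family by monotone
    convergence ([countable_limit]).  This gives at once the almost everywhere
    summability of the terms and the norm bound. *)

(** * Powers with conjugate exponents *)

Section roots.
Context {R : realType} (p : R).
Hypothesis p0 : 0 < p.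

Lemma powR_root (x : R) : 0 <= x -> (x `^ p^-1) `^ p = x.
Proof. by move=> x0; rewrite -powRrM mulVf ?gt_eqF// powRr1. Qed.

Lemma powR_rootV (x : R) : 0 <= x -> (x `^ p) `^ p^-1 = x.
Proof. by move=> x0; rewrite -powRrM mulfV ?gt_eqF// powRr1. Qed.

End roots.

Section conjugate_exponents.
Context {R : realType} (p q : R).
Hypotheses (p0 : 0 < p) (q0 : 0 < q) (pq : p^-1 + q^-1 = 1).

Lemma conj_mulr : p * q = p + q.
Proof.
have pn0 : p != 0 by rewrite gt_eqF.
have qn0 : q != 0 by rewrite gt_eqF.
by rewrite -[LHS]mulr1 -pq; field; rewrite ?pn0 ?qn0.
Qed.

Lemma conj_subr1M : (p - 1) * q = p.
Proof. by rewrite mulrBl conj_mulr mul1r addrK. Qed.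

Lemma conj_gt1 : 1 < p.
Proof. by have := conj_subr1M; rewrite -subr_gt0 -(pmulr_lgt0 _ q0) => ->. Qed.

Lemma conj_invr : p^-1 = (q - 1) / q.
Proof.
have qn0 : q != 0 by rewrite gt_eqF.
by rewrite mulrBl mulfV// mul1r -pq addrK.
Qed.

Lemma powR_split (x : R) : 0 <= x -> x `^ p^-1 * x `^ q^-1 = x.
Proof.
by move=> x0; rewrite -powRD ?pq ?powRr1// oner_eq0.
Qed.

Lemma hoelder_sum (a b : nat -> R) (N : nat) :
    (forall i, (i < N)%N -> 0 <= a i) -> (forall i, (i < N)%N -> 0 <= b i) ->
  \sum_(i < N) a i * b i <=
  (\sum_(i < N) a i `^ p) `^ p^-1 * (\sum_(i < N) b i `^ q) `^ q^-1.
Proof.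
elim: N => [_ _|N ih a0 b0].
  by rewrite !big_ord0 powR0 ?mul0r// invr_neq0 ?gt_eqF.
rewrite !big_ord_recr/=; apply: (le_trans (lerD (ih _ _) (lexx _))).
- by move=> i /ltnW; exact: a0.
- by move=> i /ltnW; exact: b0.
set A := \sum_(i < N) a i `^ p; set B := \sum_(i < N) b i `^ q.
have A0 : 0 <= A by apply: sumr_ge0 => i _; exact: powR_ge0.
have B0 : 0 <= B by apply: sumr_ge0 => i _; exact: powR_ge0.
move: A B A0 B0 => A B A0 B0.
have := hoelder2 (powR_ge0 A p^-1) (a0 _ (ltnSn N)) (powR_ge0 B q^-1)
  (b0 _ (ltnSn N)) p0 q0 pq.
by rewrite powR_root ?powR_root.
Qed.

(** An inequality that bounds a quantity by its own smaller power bounds the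
    quantity itself; this is how duality is used without naming dual spaces. *)
Lemma powR_absorb (X B : R) : 0 <= X -> 0 <= B ->
  X <= B * X `^ q^-1 -> X <= B `^ p.
Proof.
move=> X0 B0; have [->|Xn0] := eqVneq X 0; first by rewrite powR_ge0.
have Xgt0 : 0 < X by rewrite lt_def Xn0.
rewrite -{1}(powR_split X0) ler_pM2r ?powR_gt0// => h.
rewrite -[leLHS](powR_root p0)//.
apply: ge0_ler_powR; rewrite ?nnegrE ?powR_ge0//.
exact: ltW.
Qed.

(** Young's inequality for [a] and [m `^ (p - 1)], in the form that compares the
    increments of the two sides of the maximal inequality. *)
Lemma young_increment (a m : R) : 0 <= a -> 0 <= m ->
  a `^ p - m `^ p <= q * (a * (a `^ (p - 1) - m `^ (p - 1))).
Proof.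
move=> a0 m0; have p1 := conj_gt1.
have := conjugate_powR a0 (powR_ge0 m (p - 1)) p0 q0 pq.
rewrite -powRrM conj_subr1M mulrBr mulr_powRB1// => h.
have {h} : q * (a * m `^ (p - 1)) <= q * (a `^ p / p + m `^ p / q).
  by rewrite ler_pM2l.
rewrite mulrDr mulrBr; have -> : q * (a `^ p / p) = (q - 1) * a `^ p.
  have -> : q - 1 = q / p; last by ring.
  have pn0 : p != 0 by rewrite gt_eqF.
  apply: (mulIf pn0); rewrite mulrBl mulrC conj_mulr mul1r -mulrA mulVf// mulr1.
  by rewrite addrAC subrr add0r.
rewrite (_ : q * (m `^ p / q) = m `^ p); last first.
  by rewrite mulrCA mulfV ?mulr1// gt_eqF.
by rewrite mulrBl mul1r; lra.
Qed.

Lemma ereal_absorb (c : R) (X Y Z : \bar R) :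
  0 <= c -> (0 <= X -> 0 <= Y -> X < +oo -> X <= c%:E * Z ->
  Z <= Y `^ p^-1 * X `^ q^-1 -> X <= (c `^ p)%:E * Y)%E.
Proof.
move=> c0; case: X => [X||]//; case: Y => [Y||]//; last first.
  move=> X0 _ _ XZ _; have [c0'|cn0] := eqVneq c 0.
    by move: XZ; rewrite c0' mul0e powR0 ?gt_eqF// mul0e.
  by rewrite mulry gtr0_sg ?mul1e ?leey// powR_gt0// lt_def cn0.
rewrite !lee_fin !poweR_EFin => X0 Y0 _; case: Z => [Z||]//.
  rewrite -!EFinM !lee_fin => XZ ZY.
  rewrite -(powR_root p0 Y0) -powRM ?powR_ge0//.
  apply: powR_absorb => //; first by rewrite mulr_ge0 ?powR_ge0.
  by apply: (le_trans XZ); rewrite -mulrA ler_wpM2l.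
have [->|cn0] := eqVneq c 0.
  by rewrite mul0e powR0 ?gt_eqF// -EFinM mul0r.
by rewrite mulrNy gtr0_sg ?mul1e// lt_def cn0.
Qed.

End conjugate_exponents.

(** * Integrals over sets and Hoelder's inequality *)

Section integration.
Context {d} {T : measurableType d} {R : realType}.
Variable m : {measure set T -> \bar R}.
Local Open Scope ereal_scope.

Lemma integral_setI1 (f : T -> R) (A : set T) :
  \int[m]_(x in A) (f x)%:E = \int[m]_x (f x * \1_A x)%:E.
Proof.
rewrite integral_mkcond; apply: eq_integral => x _.
by rewrite patchE indicE; case: (x \in A); rewrite ?mulr1 ?mulr0.
Qed.

Lemma hoelder_integral (f g : T -> R) (p q : R) :
  measurable_fun setT f -> measurable_fun setT g ->
  (forall x, 0 <= f x)%R -> (forall x, 0 <= g x)%R ->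
  (0 < p)%R -> (0 < q)%R -> (p^-1 + q^-1 = 1)%R ->
  \int[m]_x (f x * g x)%:E <=
    (\int[m]_x (f x `^ p)%:E) `^ p^-1 * (\int[m]_x (g x `^ q)%:E) `^ q^-1.
Proof.
move=> mf mg f0 g0 p0 q0 pq; have := hoelder m mf mg p0 q0 pq.
rewrite Lnorm1 unlock /=.
under eq_integral do rewrite ger0_norm ?mulr_ge0//.
under [X in _ <= X `^ _ * _ -> _]eq_integral do rewrite ger0_norm//.
by under [X in _ <= _ * X `^ _ -> _]eq_integral do rewrite ger0_norm//.
Qed.

End integration.

(** * Carleson families *)

Section nested_families.
Context {d} {T : measurableType d} {R : realType}.
Variable m : {measure set T -> \bar R}.
Local Open Scope ereal_scope.

(** An enumeration of cubes with the larger ones first: a later cube lies in an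
    earlier one or misses it. *)
Definition nested_family (N : nat) (Q : nat -> set T) :=
  (forall i, measurable (Q i)) /\
  (forall i j, (i < j < N)%N -> Q j `<=` Q i \/ Q i `&` Q j = set0).

(** The pieces are cut from the smallest cubes up.  If [psi] is what the smaller
    cubes have left of the constant [1], the Carleson condition says that the
    pieces already cut inside [Q] use up at most [|Q| - |Q| / Lam], so [psi]
    has integral at least [|Q| / Lam] on [Q] and a fraction of it can be taken.
    Pieces of functions, unlike subsets of the cubes, can have any prescribed
    integral without an appeal to the absence of atoms. *)
Lemma carleson_fractions (N : nat) (Q : nat -> set T) (s : nat -> R) (Lam : R) :
  nested_family N Q -> (0 < Lam)%R ->
  (forall i, (i < N)%N -> m (Q i) = (s i)%:E) ->
  (forall i, (i < N)%N -> 0 < s i)%R ->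
  (forall j, (j < N)%N ->
     \sum_(j <= i < N) m (Q i `&` Q j) <= (Lam * s j)%:E) ->
  exists phi : nat -> T -> R,
    [/\ forall i, measurable_fun setT (phi i),
        forall i x, (0 <= phi i x)%R,
        forall i x, (i < N)%N -> ~ Q i x -> phi i x = 0%R,
        forall x, (\sum_(i < N) phi i x <= 1)%R &
        forall i, (i < N)%N -> \int[m]_x (phi i x)%:E = (s i / Lam)%:E].
Proof.
move=> nQ L0; elim: N Q s nQ => [|N ih] Q s [mQ nQ] mQs s0 carl.
  exists (fun _ _ => 0%R); split => // x; first by rewrite big_ord0.
have := ih (fun i => Q i.+1) (fun i => s i.+1); case => /=.
- split => [i|i j /= /andP[ij jN]]; first exact: mQ.
  by have := nQ i.+1 j.+1; rewrite !ltnS ij jN; exact.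
- by move=> i iN; rewrite mQs.
- by move=> i iN; rewrite s0.
- by move=> j jN; have := carl j.+1; rewrite big_add1/=; exact.
move=> phi [mphi phi0 phiQ phi1 iphi] {ih}.
pose psi x : R := (1 - \sum_(i < N) phi i x)%R.
have psi0 x : (0 <= psi x)%R by rewrite subr_ge0.
have mpsi : measurable_fun setT psi.
  by apply: measurable_funB => //; exact: measurable_sum.
have m1 : measurable_fun setT (\1_(Q 0%N) : T -> R) by exact: measurable_indic.
have I0 x : (0 <= \1_(Q 0%N) x :> R)%R by rewrite indicE.
have splitQ : \int[m]_x (psi x * \1_(Q 0%N) x)%:E +
    \sum_(i < N) \int[m]_x (phi i x * \1_(Q 0%N) x)%:E = (s 0%N)%:E.
  rewrite -ge0_integral_sum//; last 2 first.
  - by move=> i; apply/measurable_EFinP; exact: measurable_funM.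
  - by move=> i x _; rewrite lee_fin mulr_ge0.
  rewrite -ge0_integralD//; last 4 first.
  - by move=> x _; rewrite lee_fin mulr_ge0.
  - by apply/measurable_EFinP; exact: measurable_funM.
  - by move=> x _; apply: sume_ge0 => i _; rewrite lee_fin mulr_ge0.
  - apply: emeasurable_sum => i.
    by apply/measurable_EFinP; exact: measurable_funM.
  rewrite -mQs// -[in RHS](setIT (Q 0%N)) -integral_indic//.
  apply: eq_integral => x _.
  by rewrite sumEFin -EFinD -mulr_suml -mulrDl /psi subrK mul1r.
have partQ (i : 'I_N) : \int[m]_x (phi i x * \1_(Q 0%N) x)%:E <=
    (Lam^-1)%:E * m (Q i.+1 `&` Q 0%N).
  have [QQ|QQ] : Q i.+1 `<=` Q 0%N \/ Q 0%N `&` Q i.+1 = set0.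
  + by apply: nQ; rewrite !ltnS/=.
  + rewrite (setIidl QQ) mQs ?ltnS// -EFinM mulrC -iphi//.
    apply: ge0_le_integral => //.
    * by move=> x _; rewrite lee_fin mulr_ge0.
    * by apply/measurable_EFinP; exact: measurable_funM.
    * by apply/measurable_EFinP.
    * by move=> x _; rewrite lee_fin ler_piMr// indicE lern1 leq_b1.
  + rewrite setIC QQ measure0 mule0 integral0_eq// => x _.
    rewrite indicE; case: (boolP (x \in Q 0%N)); rewrite ?mulr0// inE => Qx.
    rewrite mulr1 phiQ//= => Qix.
    by have : (Q 0%N `&` Q i.+1) x by []; rewrite QQ.
have sumQ : \sum_(i < N) \int[m]_x (phi i x * \1_(Q 0%N) x)%:E <=
    (s 0%N - s 0%N / Lam)%:E.
  apply: (le_trans (lee_sum _ (fun i _ => partQ i))).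
  have := carl 0%N (ltn0Sn _).
  rewrite big_nat_recl// setIid mQs// big_mkord -ge0_sume_distrr//.
  have : 0 <= \sum_(i < N) m (Q i.+1 `&` Q 0%N) by exact: sume_ge0.
  case: (\sum_(i < N) _) => [r||]//; rewrite -EFinD -EFinM !lee_fin => r0 h.
  rewrite mulrC ler_pdivrMr// mulrBl divfK ?gt_eqF//; lra.
set J := \int[m]_x _ in splitQ.
have J0 : 0 <= J.
  by apply: integral_ge0 => x _; rewrite lee_fin mulr_ge0.
have [t Jt] : exists t, J = t%:E.
  move: splitQ sumQ; case: J J0 => [t _|//|//]; first by exists t.
  by case: (\sum_(i < N) _).
have tge : (s 0%N / Lam <= t)%R.
  move: splitQ sumQ; rewrite Jt; case: (\sum_(i < N) _) => [r||]//.
  by rewrite -EFinD => -[<-]; rewrite lee_fin; lra.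
have sL0 : (0 < s 0%N / Lam)%R by rewrite divr_gt0 ?s0.
have t0 : (0 < t)%R by exact: lt_le_trans tge.
(* the fraction of what is left in the largest cube that this cube takes *)
pose c := (s 0%N / Lam / t)%R.
have c0 : (0 <= c)%R by rewrite /c divr_ge0// ltW.
have c1 : (c <= 1)%R by rewrite /c ler_pdivrMr// mul1r.
pose phi0' x := (c * (psi x * \1_(Q 0%N) x))%R.
have phi0'0 x : (0 <= phi0' x)%R by rewrite mulr_ge0// mulr_ge0.
exists (fun i => if i is j.+1 then phi j else phi0'); split.
- by case=> // ; do 2 apply: measurable_funM => //.
- by case.
- case=> [x _ nQx|i x iN nQx]; last by rewrite phiQ.
  by rewrite /phi0' indicE memNset// !mulr0.
- move=> x; rewrite big_ord_recl/= -[leRHS](subrK (\sum_(i < N) phi i x)%R).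
  rewrite lerD2r -/(psi x) /phi0' mulrCA ler_piMr//.
  by rewrite mulr_ile1// indicE lern1 leq_b1.
- case=> [_|i iN]; last by rewrite iphi.
  rewrite /phi0'; under eq_integral do rewrite EFinM.
  rewrite ge0_integralZl_EFin//; last 2 first.
  + by move=> x _; rewrite lee_fin mulr_ge0.
  + by apply/measurable_EFinP; exact: measurable_funM.
  by rewrite -/J Jt -EFinM /c divfK// gt_eqF.
Qed.

End nested_families.

(** * The maximal inequality *)

Section maximal_function.
Context {d} {T : measurableType d} {R : realType}.
Variable m : {measure set T -> \bar R}.
Local Open Scope ereal_scope.

(** The pairing of [L^p] of the weight [w `^ (1 - p)] with [L^q] of [w]: this is
    the form in which a weight meets its conjugate weight. *)
Lemma weighted_hoelder (f g w : T -> R) (p q : R) :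
  measurable_fun setT f -> measurable_fun setT g -> measurable_fun setT w ->
  (forall x, 0 <= f x)%R -> (forall x, 0 <= g x)%R -> (forall x, 0 < w x)%R ->
  (0 < p)%R -> (0 < q)%R -> (p^-1 + q^-1 = 1)%R ->
  \int[m]_x (f x * g x)%:E <=
    (\int[m]_x (f x `^ p * w x `^ (1 - p))%:E) `^ p^-1 *
    (\int[m]_x (g x `^ q * w x)%:E) `^ q^-1.
Proof.
move=> mf mg mw f0 g0 w0 p0 q0 pq.
have mpow r : measurable_fun setT (fun x => w x `^ r)%R.
  exact: measurableT_comp (measurable_powR _) mw.
have := @hoelder_integral _ _ _ m (fun x => f x * w x `^ (- q^-1))%R
  (fun x => g x * w x `^ q^-1)%R p q.
have fw0 x : (0 <= f x * w x `^ (- q^-1))%R by rewrite mulr_ge0 ?powR_ge0.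
have gw0 x : (0 <= g x * w x `^ q^-1)%R by rewrite mulr_ge0 ?powR_ge0.
move=> /(_ (measurable_funM mf (mpow _)) (measurable_funM mg (mpow _)) fw0 gw0).
move=> /(_ p0 q0 pq).
under eq_integral.
  move=> x _; rewrite mulrACA -powRD; last by apply/implyP => _; rewrite gt_eqF.
  by rewrite addNr powRr0 mulr1; over.
move=> /le_trans; apply.
have e1 : (- q^-1 * p = 1 - p)%R.
  have -> : (q^-1 = 1 - p^-1)%R by rewrite -pq addrAC subrr add0r.
  by rewrite mulNr mulrBl mul1r mulVf ?gt_eqF// opprB.
have eF x : ((f x * w x `^ (- q^-1)) `^ p = f x `^ p * w x `^ (1 - p))%R.
  by rewrite (powRM _ (f0 x) (powR_ge0 _ _)) -powRrM e1.
have eG x : ((g x * w x `^ q^-1) `^ q = g x `^ q * w x)%R.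
  by rewrite (powRM _ (g0 x) (powR_ge0 _ _)) powR_root// ltW.
rewrite le_eqVlt; apply/predU1P; left.
by congr (_ `^ _ * _ `^ _); apply: eq_integral => x _; rewrite ?eF ?eG.
Qed.

(** The cubes are added one at a time, so that the maximal inequality can be
    proved by induction on their number; the value [0] away from the cubes is
    harmless as the averages are nonnegative. *)
Fixpoint maximal (a : nat -> R) (Q : nat -> set T) (N : nat) (x : T) : R :=
  if N is k.+1 then Num.max (maximal a Q k x) (a k * \1_(Q k) x)%R else 0%R.

Section properties.
Variables (a : nat -> R) (Q : nat -> set T).

Lemma maximal_ge0 N x : (0 <= maximal a Q N x)%R.
Proof. by elim: N => //= N ih; rewrite le_max ih. Qed.

Lemma maximal_ge N i x : (i < N)%N -> Q i x -> (a i <= maximal a Q N x)%R.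
Proof.
elim: N => //= N ih; rewrite ltnS leq_eqVlt => /predU1P[->|iN] Qx.
  by rewrite le_max indicE mem_set// mulr1 lexx orbT.
by rewrite le_max ih.
Qed.

Lemma measurable_maximal N : (forall i, measurable (Q i)) ->
  measurable_fun setT (maximal a Q N).
Proof.
move=> mQ; elim: N => //= N ih; apply: measurable_maxr => //.
by apply: measurable_funM => //; exact: measurable_indic.
Qed.

Lemma maximal_const N k j x y : nested_family N Q -> (k <= j)%N -> (j < N)%N ->
  Q j x -> Q j y -> maximal a Q k x = maximal a Q k y.
Proof.
move=> [_ nQ] + jN Qx Qy; elim: k => //= k ih kj.
rewrite ih 1?ltnW//; congr Num.max.
have [|QQ|QQ] := nQ k j; first by rewrite kj.
  by rewrite !indicE !mem_set//; exact: QQ.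
rewrite !indicE !memNset// => Qk.
  by have : (Q k `&` Q j) y by []; rewrite QQ.
by have : (Q k `&` Q j) x by []; rewrite QQ.
Qed.

(** Adding one cube that is smaller than the previous ones changes the maximal
    function only on this cube, where it was constant. *)
Lemma integral_maximal_recr N (g : T -> R) (e c : R) :
  (forall i, measurable (Q i)) ->
  measurable_fun setT g -> (forall x, 0 <= g x)%R -> (0 < e)%R ->
  (forall x, Q N x -> maximal a Q N x = c) -> (0 <= c < a N)%R ->
  \int[m]_x (g x * maximal a Q N.+1 x `^ e)%:E =
  \int[m]_x (g x * maximal a Q N x `^ e)%:E +
    (a N `^ e - c `^ e)%:E * \int[m]_(x in Q N) (g x)%:E.
Proof.
move=> mQ mg g0 e0 Mc /andP[c0 ca].
have mM := measurable_maximal N mQ.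
have a0 : (0 <= a N)%R by rewrite (le_trans c0)// ltW.
have inc : (0 <= a N `^ e - c `^ e)%R.
  by rewrite subr_ge0; apply: ge0_ler_powR; rewrite ?nnegrE// ltW.
have mI : measurable_fun setT (\1_(Q N) : T -> R) by exact: measurable_indic.
rewrite integral_setI1 -ge0_integralZl_EFin//; last 2 first.
- by move=> x _; rewrite lee_fin mulr_ge0// indicE.
- by apply/measurable_EFinP; exact: measurable_funM.
rewrite -ge0_integralD//.
- apply: eq_integral => x _ /=; rewrite -EFinM -EFinD; congr EFin.
  rewrite indicE; case: (boolP (x \in Q N)) => [|_]; last first.
    by rewrite !mulr0 addr0 max_l// maximal_ge0.
  rewrite inE => Qx; rewrite !mulr1 Mc// max_r ?ltW//.
  by rewrite mulrBl ![(g x * _)%R]mulrC; ring.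
- by move=> x _; rewrite lee_fin mulr_ge0// powR_ge0.
- apply/measurable_EFinP; apply: measurable_funM => //.
  exact: measurableT_comp (measurable_powR _) mM.
- by move=> x _; rewrite -EFinM lee_fin !mulr_ge0// indicE.
- apply/measurable_EFinP; apply: measurable_funM => //.
  exact: measurable_funM.
Qed.

End properties.

(** Doob's argument, one cube at a time: when a cube raises the maximal function
    from [c] to the average [a] of [f] against [w], the left side grows by
    [(a `^ p - c `^ p) * w(Q)] and the right side by
    [q * (a `^ (p - 1) - c `^ (p - 1)) * a * w(Q)], since [a * w(Q)] is the
    integral of [f]; Young's inequality compares the two. *)
Lemma doob_maximal (f w : T -> R) (p q : R) (N : nat) (Q : nat -> set T)
    (W F : nat -> R) :
  (0 < p)%R -> (0 < q)%R -> (p^-1 + q^-1 = 1)%R ->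
  nested_family N Q ->
  measurable_fun setT f -> measurable_fun setT w ->
  (forall x, 0 <= f x)%R -> (forall x, 0 <= w x)%R ->
  (forall i, (i < N)%N -> 0 < W i)%R ->
  (forall i, (i < N)%N -> \int[m]_(x in Q i) (w x)%:E = (W i)%:E) ->
  (forall i, (i < N)%N -> \int[m]_(x in Q i) (f x)%:E = (F i)%:E) ->
  let M := maximal (fun i => F i / W i)%R Q N in
  \int[m]_x (w x * M x `^ p)%:E < +oo /\
  \int[m]_x (w x * M x `^ p)%:E <=
    q%:E * \int[m]_x (f x * M x `^ (p - 1))%:E.
Proof.
move=> p0 q0 pq [mQ nQ] mf mw f0 w0 W0 wQ fQ /=.
have p1 : (0 < p - 1)%R by rewrite subr_gt0 (conj_gt1 p0 q0 pq).
set a := (fun i => F i / W i)%R.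
have : (N <= N)%N by []; elim: {1 3 4 5}N => [|k ih] kN.
  have -> : \int[m]_x (w x * maximal a Q 0 x `^ p)%:E = 0.
    by apply: integral0_eq => x _ /=; rewrite powR0 ?mulr0// gt_eqF.
  split => //; apply: mule_ge0; first by rewrite lee_fin ltW.
  by apply: integral_ge0 => x _; rewrite lee_fin mulr_ge0// powR_ge0.
have {ih}[ihoo ih] := ih (ltnW kN).
have F0 : (0 <= F k)%R.
  by rewrite -lee_fin -fQ//; apply: integral_ge0 => x _; rewrite lee_fin.
have a0 : (0 <= a k)%R by rewrite divr_ge0// ltW// W0.
have aW : (a k * W k = F k)%R by rewrite divfK// gt_eqF// W0.
have [c cE] : exists c, forall x, Q k x -> maximal a Q k x = c.
  have [->|/set0P[y Qy]] := eqVneq (Q k) set0; first by exists 0%R.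
  exists (maximal a Q k y) => x Qx.
  exact: (@maximal_const a Q N k k).
have [y Qy] : Q k !=set0.
  apply/set0P/negP => /eqP Q0; have := wQ _ kN.
  by rewrite Q0 integral_set0 => -[] /eqP; rewrite lt_eqF// W0.
have c0 : (0 <= c)%R by rewrite -(cE _ Qy) maximal_ge0.
have [ca|ac] := ltP c (a k); last first.
  have -> : maximal a Q k.+1 = maximal a Q k; last by [].
  apply/funext => x /=; apply/max_idPl; rewrite indicE.
  case: (boolP (x \in Q k)) => [|_]; last by rewrite mulr0 maximal_ge0.
  by rewrite inE => Qx; rewrite mulr1 cE.
rewrite !(@integral_maximal_recr a Q k _ _ c)// ?c0// wQ// fQ//.
split; first by rewrite lte_add_pinfty// -EFinM ltry.
rewrite ge0_muleDr; last 2 first.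
- by apply: integral_ge0 => x _; rewrite lee_fin mulr_ge0// powR_ge0.
- rewrite -EFinM lee_fin mulr_ge0// subr_ge0.
  by apply: ge0_ler_powR; rewrite ?nnegrE// ltW.
apply: leeD => //; rewrite -!EFinM lee_fin -aW.
have := young_increment p0 q0 pq a0 c0.
rewrite -(ler_pM2r (W0 _ kN)) => /le_trans; apply.
by rewrite le_eqVlt; apply/orP; left; apply/eqP; ring.
Qed.

(** Hoelder's inequality turns the previous bound into one of the finite
    integral of [w * M `^ p] by its own power [q^-1]. *)
Lemma maximal_bound (f w : T -> R) (p q : R) (N : nat) (Q : nat -> set T)
    (W F : nat -> R) :
  (0 < p)%R -> (0 < q)%R -> (p^-1 + q^-1 = 1)%R ->
  nested_family N Q ->
  measurable_fun setT f -> measurable_fun setT w ->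
  (forall x, 0 <= f x)%R -> (forall x, 0 < w x)%R ->
  (forall i, (i < N)%N -> 0 < W i)%R ->
  (forall i, (i < N)%N -> \int[m]_(x in Q i) (w x)%:E = (W i)%:E) ->
  (forall i, (i < N)%N -> \int[m]_(x in Q i) (f x)%:E = (F i)%:E) ->
  \int[m]_x (w x * maximal (fun i => F i / W i) Q N x `^ p)%:E <=
    (q `^ p)%:E * \int[m]_x (f x `^ p * w x `^ (1 - p))%:E.
Proof.
move=> p0 q0 pq nQ mf mw f0 w0 W0 wQ fQ.
have [] := @doob_maximal f w p q N Q W F p0 q0 pq nQ mf mw f0 _ W0 wQ fQ.
  by move=> x; exact: ltW.
set M := maximal _ Q N.
have mM : measurable_fun setT (fun x => M x `^ (p - 1))%R.
  apply: measurableT_comp (measurable_powR _) _.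
  by apply: measurable_maximal; case: nQ.
move=> Moo MfM.
have fM := @weighted_hoelder f (fun x => M x `^ (p - 1))%R w p q
  mf mM mw f0 (fun x => powR_ge0 _ _) w0 p0 q0 pq.
have eM x : ((M x `^ (p - 1)) `^ q * w x = w x * M x `^ p)%R.
  by rewrite -powRrM (conj_subr1M p0 q0 pq) mulrC.
rewrite (funext (fun x => congr1 EFin (eM x))) in fM.
apply: (ereal_absorb p0 pq (ltW q0) _ _ Moo MfM fM).
- by apply: integral_ge0 => x _; rewrite lee_fin mulr_ge0 ?powR_ge0// ltW.
- by apply: integral_ge0 => x _; rewrite lee_fin mulr_ge0 ?powR_ge0.
Qed.

End maximal_function.

(** * The Carleson embedding *)

Section embedding.
Context {d} {T : measurableType d} {R : realType}.
Variable m : {measure set T -> \bar R}.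
Local Open Scope ereal_scope.

(** Hoelder's inequality applied to a piece [phi i] and to the indicator of
    [Q i] gives [s i / Lam <= w(phi i) `^ q^-1 * V i `^ p^-1], and the weight
    condition turns this into [W i <= K * Lam `^ q * w(phi i)].  The pieces have
    sum at most [1] and live where the maximal function is at least
    [F i / W i], so the sum is at most [K * Lam `^ q] times the integral of
    [w * M `^ p]. *)
Lemma carleson_embedding (p q Lam K : R) (N : nat) (Q : nat -> set T)
    (s W V F : nat -> R) (f w : T -> R) :
  (0 < p)%R -> (0 < q)%R -> (p^-1 + q^-1 = 1)%R -> (0 < Lam)%R -> (0 <= K)%R ->
  nested_family N Q ->
  (forall i, (i < N)%N -> m (Q i) = (s i)%:E) ->
  (forall i, (i < N)%N -> 0 < s i)%R ->
  (forall j, (j < N)%N ->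
     \sum_(j <= i < N) m (Q i `&` Q j) <= (Lam * s j)%:E) ->
  measurable_fun setT f -> measurable_fun setT w ->
  (forall x, 0 <= f x)%R -> (forall x, 0 < w x)%R ->
  (forall i, (i < N)%N -> 0 < W i)%R -> (forall i, (i < N)%N -> 0 < V i)%R ->
  (forall i, (i < N)%N -> \int[m]_(x in Q i) (w x)%:E = (W i)%:E) ->
  (forall i, (i < N)%N ->
    \int[m]_(x in Q i) (w x `^ (1 - p))%:E = (V i)%:E) ->
  (forall i, (i < N)%N -> W i / s i * (V i / s i) `^ (q - 1) <= K)%R ->
  (forall i, (i < N)%N -> \int[m]_(x in Q i) (f x)%:E = (F i)%:E) ->
  (\sum_(i < N) W i * (F i / W i) `^ p)%:E <=
    (K * Lam `^ q * q `^ p)%:E * \int[m]_x (f x `^ p * w x `^ (1 - p))%:E.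
Proof.
move=> p0 q0 pq L0 K0 nQ mQs s0 carl mf mw f0 w0 W0 V0 wQ vQ WVK fQ.
have qp : (q^-1 + p^-1 = 1)%R by rewrite addrC.
have [phi [mphi phi0 phiQ phi1 iphi]] := carleson_fractions nQ L0 mQs s0 carl.
have mQ := nQ.1.
have mwp : measurable_fun setT (fun x => w x `^ (1 - p))%R.
  exact: measurableT_comp (measurable_powR _) mw.
have phile1 (i : 'I_N) x : (phi i x <= 1)%R.
  apply: le_trans (phi1 x); rewrite (bigD1 i)//= lerDl.
  by apply: sumr_ge0 => k _; exact: phi0.
have phiw (i : 'I_N) :
    (W i)%:E <= (K * Lam `^ q)%:E * \int[m]_x (phi i x * w x)%:E.
  have mI : measurable_fun setT (\1_(Q i) : T -> R) by exact: measurable_indic.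
  have I0 x : (0 <= \1_(Q i) x :> R)%R by rewrite indicE.
  have := @weighted_hoelder _ _ _ m (phi i) (\1_(Q i))
    (fun x => w x `^ (1 - p))%R q p (mphi i) mI mwp (phi0 i) I0
    (fun x => powR_gt0 _ (w0 x)) q0 p0 qp.
  have -> : \int[m]_x (phi i x * \1_(Q i) x)%:E = (s i / Lam)%:E.
    rewrite -iphi//; apply: eq_integral => x _; rewrite indicE.
    case: (boolP (x \in Q i)) => [_|]; first by rewrite mulr1.
    by rewrite notin_setE => nQx; rewrite phiQ// mul0r.
  have -> : \int[m]_x (\1_(Q i) x `^ p * w x `^ (1 - p))%:E = (V i)%:E.
    rewrite -vQ// [RHS]integral_setI1; apply: eq_integral => x _; rewrite indicE.
    case: (x \in Q i); first by rewrite powR1 mulrC.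
    by rewrite powR0 ?gt_eqF// mul0r mulr0.
  (* hence the conjugate weight of [w `^ (1 - p)] is [w] again *)
  have cpq : ((1 - p) * (1 - q) = 1)%R.
    by have := conj_mulr p0 q0 pq; lra.
  move=> /le_trans => /(_ ((\int[m]_x (phi i x * w x)%:E) `^ q^-1 *
    (V i)%:E `^ p^-1)); rewrite {1}poweR_EFin => h.
  have {h} : (s i / Lam)%:E <=
      (\int[m]_x (phi i x * w x)%:E) `^ q^-1 * (V i)%:E `^ p^-1.
    apply: h; rewrite poweR_EFin lee_wpmul2r ?lee_fin ?powR_ge0//.
    apply: gt0_ler_poweR; first by rewrite invr_ge0 ltW.
    - rewrite in_itv/= leey andbT.
      by apply: integral_ge0 => x _; rewrite lee_fin mulr_ge0 ?powR_ge0.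
    - rewrite in_itv/= leey andbT.
      by apply: integral_ge0 => x _; rewrite lee_fin mulr_ge0// ltW.
    apply: ge0_le_integral => //.
    - by move=> x _; rewrite lee_fin mulr_ge0 ?powR_ge0.
    - apply/measurable_EFinP; apply: measurable_funM.
        exact: measurableT_comp (measurable_powR _) (mphi i).
      exact: measurableT_comp (measurable_powR _) mwp.
    - by apply/measurable_EFinP; exact: measurable_funM.
    - move=> x _; rewrite lee_fin -powRrM cpq powRr1; last exact: ltW.
      rewrite ler_pM2r//; have [->|phin0] := eqVneq (phi i x) 0%R.
        by rewrite powR0// gt_eqF.
      apply: ge1r_powR; first by rewrite lt_def phin0 phi0 phile1.
      by rewrite ltW// (conj_gt1 q0 p0 qp).
  have : 0 <= \int[m]_x (phi i x * w x)%:E.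
    by apply: integral_ge0 => x _; rewrite lee_fin mulr_ge0// ltW.
  have : \int[m]_x (phi i x * w x)%:E < +oo.
    have <- : \int[m]_(x in Q i) (phi i x * w x)%:E =
        \int[m]_x (phi i x * w x)%:E.
      rewrite integral_setI1; apply: eq_integral => x _; rewrite indicE.
      case: (boolP (x \in Q i)) => [_|]; first by rewrite mulr1.
      by rewrite notin_setE => nQx; rewrite phiQ// mul0r mul0r.
    apply: le_lt_trans (ltry (W i)); rewrite -wQ//.
    apply: ge0_le_integral => //.
    - by move=> x _; rewrite lee_fin mulr_ge0// ltW.
    - by apply/measurable_EFinP; apply: measurable_funTS; exact: measurable_funM.
    - by apply/measurable_EFinP; exact: measurable_funTS.
    - by move=> x _; rewrite lee_fin ler_piMl// ltW.
  case: (\int[m]_x _) => [D _||]//; rewrite !poweR_EFin -!EFinM !lee_fin => D0 h.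
  have si0 := s0 _ (ltn_ord i); have Vi0 := V0 _ (ltn_ord i).
  have Wi0 := W0 _ (ltn_ord i).
  have {h} h : ((s i / Lam) `^ q <= D * V i `^ (q - 1))%R.
    have -> : (D * V i `^ (q - 1) = (D `^ q^-1 * V i `^ p^-1) `^ q)%R.
      rewrite powRM ?powR_ge0// powR_root// -powRrM (conj_invr q0 pq).
      by rewrite divfK// gt_eqF.
    apply: ge0_ler_powR => //; rewrite ?nnegrE.
    - exact: ltW.
    - by rewrite divr_ge0// ltW.
    - by rewrite mulr_ge0 ?powR_ge0.
  have := WVK _ (ltn_ord i).
  have -> : (W i / s i * (V i / s i) `^ (q - 1) =
             W i * V i `^ (q - 1) / s i `^ q)%R.
    rewrite powRM ?invr_ge0 ?ltW// -(mulr_powRB1 (ltW si0) q0).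
    rewrite -[in X in (_ * (_ * X) = _)%R]powR_inv1 ?ltW// powRAC powR_inv1.
      by rewrite invfM; ring.
    exact: powR_ge0.
  rewrite ler_pdivrMr ?powR_gt0// => {}WVK.
  rewrite -(ler_pM2r (powR_gt0 (q - 1) Vi0)); apply: (le_trans WVK).
  rewrite -!mulrA ler_wpM2l//.
  have -> : (s i `^ q = Lam `^ q * (s i / Lam) `^ q)%R.
    by rewrite -powRM ?ltW ?divr_gt0// mulrC divfK// gt_eqF.
  by rewrite ler_wpM2l ?powR_ge0.
set a := (fun i => F i / W i)%R.
have F0 i : (i < N)%N -> (0 <= F i)%R.
  by move=> iN; rewrite -lee_fin -fQ//; apply: integral_ge0 => x _; rewrite lee_fin.
have a0 i : (i < N)%N -> (0 <= a i)%R.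
  by move=> iN; rewrite divr_ge0 ?F0// ltW// W0.
have mM := measurable_maximal a N mQ.
apply: (@le_trans _ _ ((K * Lam `^ q)%:E *
    \int[m]_x (w x * maximal a Q N x `^ p)%:E)); last first.
  rewrite [in leRHS]EFinM -[leRHS]muleA lee_wpmul2l ?lee_fin ?mulr_ge0 ?powR_ge0//.
  exact: maximal_bound.
apply: (@le_trans _ _ ((K * Lam `^ q)%:E *
    \sum_(i < N) (a i `^ p)%:E * \int[m]_x (phi i x * w x)%:E)).
  rewrite -sumEFin ge0_sume_distrr; last first.
    move=> i _; apply: mule_ge0; first by rewrite lee_fin powR_ge0.
    by apply: integral_ge0 => x _; rewrite lee_fin mulr_ge0// ltW.
  apply: lee_sum => i _; rewrite muleCA EFinM muleC lee_wpmul2l//.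
  by rewrite lee_fin powR_ge0.
rewrite lee_wpmul2l ?lee_fin ?mulr_ge0 ?powR_ge0//.
have mpw i : measurable_fun setT (fun x => (phi i x * w x)%:E).
  by apply/measurable_EFinP; exact: measurable_funM.
under eq_bigr => i _.
  rewrite -ge0_integralZl_EFin ?powR_ge0//; last first.
    by move=> x _; rewrite lee_fin mulr_ge0// ltW.
  over.
rewrite -ge0_integral_sum//; last 2 first.
- by move=> i; exact: measurable_funeM.
- by move=> i x _; rewrite -EFinM lee_fin !mulr_ge0 ?powR_ge0// ltW.
apply: ge0_le_integral => //.
- move=> x _; apply: sume_ge0 => i _.
  by rewrite -EFinM lee_fin !mulr_ge0 ?powR_ge0// ltW.
- by apply: emeasurable_sum => i; exact: measurable_funeM.
- apply/measurable_EFinP; apply: measurable_funM => //.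
  exact: measurableT_comp (measurable_powR _) mM.
- move=> x _; rewrite [leLHS]sumEFin lee_fin.
  rewrite (eq_bigr (fun i : 'I_N => w x * (phi i x * a i `^ p))%R); last first.
    by move=> i _; ring.
  rewrite -mulr_sumr ler_pM2l//.
  apply: (@le_trans _ _ (\sum_(i < N) phi i x * maximal a Q N x `^ p)%R).
    apply: ler_sum => i _; have [Qx|nQx] := pselect (Q i x); last first.
      by rewrite phiQ// !mul0r.
    apply: ler_wpM2l => //; apply: ge0_ler_powR; rewrite ?nnegrE.
    - exact: ltW.
    - exact: a0.
    - exact: maximal_ge0.
    - exact: maximal_ge.
  by rewrite -mulr_suml ler_piMl ?powR_ge0.
Qed.

End embedding.

(** * The bound for finite families *)

Section two_weights.
Context {d} {T : measurableType d} {R : realType}.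
Variable m : {measure set T -> \bar R}.
Local Open Scope ereal_scope.

Lemma integral_bloom_weight (u l : T -> R) (p q : R) (A : set T) :
  (0 < p)%R -> (0 < q)%R -> (p^-1 + q^-1 = 1)%R -> measurable A ->
  measurable_fun setT u -> measurable_fun setT l ->
  (forall x, 0 < u x)%R -> (forall x, 0 < l x)%R ->
  \int[m]_(x in A) (u x `^ p^-1 * l x `^ (- p^-1))%:E <=
  (\int[m]_(x in A) (u x)%:E) `^ p^-1 *
  (\int[m]_(x in A) (l x `^ (1 - q))%:E) `^ q^-1.
Proof.
move=> p0 q0 pq mA mu ml u0 l0.
have mI : measurable_fun setT (\1_A : T -> R) by exact: measurable_indic.
have I0 x : (0 <= \1_A x :> R)%R by rewrite indicE.
have qE : (p^-1 * q = q - 1)%R by rewrite (conj_invr q0 pq) divfK// gt_eqF.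
have mf1 : measurable_fun setT (fun x => u x `^ p^-1 * \1_A x)%R.
  by apply: measurable_funM => //; exact: measurableT_comp (measurable_powR _) mu.
have mg1 : measurable_fun setT (fun x => l x `^ (- p^-1) * \1_A x)%R.
  by apply: measurable_funM => //; exact: measurableT_comp (measurable_powR _) ml.
have := @hoelder_integral _ _ _ m _ _ p q mf1 mg1
  (fun x => mulr_ge0 (powR_ge0 _ _) (I0 x))
  (fun x => mulr_ge0 (powR_ge0 _ _) (I0 x)) p0 q0 pq.
move=> h; rewrite !(integral_setI1 m _ A); apply: (le_trans _ (le_trans h _)).
  rewrite le_eqVlt; apply/predU1P; left; apply: eq_integral => x _.
  by congr EFin; rewrite indicE; case: (x \in A); rewrite ?mulr1 ?mulr0.
rewrite le_eqVlt; apply/predU1P; left; congr (_ `^ _ * _ `^ _).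
- apply: eq_integral => x _; congr EFin; rewrite indicE.
  case: (x \in A); last by rewrite !mulr0 powR0// gt_eqF.
  by rewrite !mulr1 powR_root// ltW.
- apply: eq_integral => x _; congr EFin; rewrite indicE.
  case: (x \in A); last by rewrite !mulr0 powR0// gt_eqF.
  by rewrite !mulr1 -powRrM mulNr qE opprB.
Qed.

(** The constants of the two classes enter with the powers [q^-1] and [p^-1];
    the missing powers come from the two Carleson embeddings. *)
Lemma two_weight_term (p q s n U U' L L' K1 K2 : R) :
  (0 < p)%R -> (0 < q)%R -> (p^-1 + q^-1 = 1)%R ->
  (0 < s)%R -> (0 < U)%R -> (0 < U')%R -> (0 < L)%R -> (0 < L')%R ->
  (n <= U `^ p^-1 * L' `^ q^-1)%R ->
  (U' / s * (U / s) `^ (q - 1) <= K1)%R ->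
  (L / s * (L' / s) `^ (p - 1) <= K2)%R ->
  (n / s * (U' / s) * L <=
    K1 `^ q^-1 * K2 `^ p^-1 * (U' `^ p^-1 * L `^ q^-1))%R.
Proof.
move=> p0 q0 pq s0 U0 U'0 L0 L'0 nU UK LK.
have qp : (q^-1 + p^-1 = 1)%R by rewrite addrC.
have pge0 : (0 <= p^-1)%R by rewrite invr_ge0 ltW.
have qge0 : (0 <= q^-1)%R by rewrite invr_ge0 ltW.
have UK0 : (0 <= U' / s * (U / s) `^ (q - 1))%R.
  by rewrite mulr_ge0 ?powR_ge0 ?divr_ge0//; exact: ltW.
have LK0 : (0 <= L / s * (L' / s) `^ (p - 1))%R.
  by rewrite mulr_ge0 ?powR_ge0 ?divr_ge0//; exact: ltW.
have UK' : ((U' / s) `^ q^-1 * (U / s) `^ p^-1 <= K1 `^ q^-1)%R.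
  rewrite [in X in (_ * X <= _)%R](conj_invr q0 pq) powRrM -powRM ?powR_ge0//.
    by apply: ge0_ler_powR; rewrite ?nnegrE// (le_trans _ UK).
  by rewrite divr_ge0//; exact: ltW.
have LK' : ((L / s) `^ p^-1 * (L' / s) `^ q^-1 <= K2 `^ p^-1)%R.
  rewrite [in X in (_ * X <= _)%R](conj_invr p0 qp) powRrM -powRM ?powR_ge0//.
    by apply: ge0_ler_powR; rewrite ?nnegrE// (le_trans _ LK).
  by rewrite divr_ge0//; exact: ltW.
have sinv0 : (0 <= s^-1)%R by rewrite invr_ge0 ltW.
have split x : (0 < x)%R -> (x = x `^ p^-1 * x `^ q^-1)%R.
  by move=> x0; rewrite powR_split// ltW.
have nE : (n / s <= (U / s) `^ p^-1 * (L' / s) `^ q^-1)%R.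
  rewrite !powRM// ?(ltW U0) ?(ltW L'0)// mulrACA.
  rewrite powR_split//; exact: ler_wpM2r.
have h := ler_pM (mulr_ge0 (powR_ge0 _ _) (powR_ge0 _ _))
  (mulr_ge0 (powR_ge0 _ _) (powR_ge0 _ _)) UK' LK'.
have -> : (U' `^ p^-1 * L `^ q^-1 = s * ((U' / s) `^ p^-1 * (L / s) `^ q^-1))%R.
  rewrite !powRM// ?(ltW U'0) ?(ltW L0)// mulrACA powR_split// mulrCA.
  by rewrite mulfV ?mulr1// gt_eqF.
apply: le_trans (ler_wpM2r _ h); last first.
  by rewrite !mulr_ge0 ?powR_ge0// ltW.
have -> : (n / s * (U' / s) * L = s * ((U' / s) * (L / s)) * (n / s))%R.
  by field; rewrite gt_eqF.
apply: le_trans (ler_wpM2l _ nE) _.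
  by rewrite !mulr_ge0// ltW.
rewrite {1}(split (U' / s)%R) ?divr_gt0// {1}(split (L / s)%R) ?divr_gt0//.
by rewrite le_eqVlt; apply/orP; left; apply/eqP; ring.
Qed.

End two_weights.

Section finite_families.
Context {d} {T : measurableType d} {R : realType}.
Variable m : {measure set T -> \bar R}.
Local Open Scope ereal_scope.

Lemma chain_powR (p q k A1 A2 c1 c2 X Y : R) : (0 < p)%R -> (0 < q)%R ->
  (0 <= k)%R -> (0 <= A1)%R -> (0 <= A2)%R -> (0 <= c1)%R -> (0 <= c2)%R ->
  (0 <= Y)%R -> (0 <= X)%R ->
  (X <= k * (A1 `^ p^-1 * A2 `^ q^-1) -> A1 <= c1 * Y -> A2 <= c2 * X ->
  X <= k * (c1 `^ p^-1 * c2 `^ q^-1) * (Y `^ p^-1 * X `^ q^-1))%R.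
Proof.
move=> p0 q0 k0 A10 A20 c10 c20 Y0 X0 XA A1Y A2X; apply: (le_trans XA).
rewrite -[leRHS]mulrA mulrACA -!powRM// ler_wpM2l//.
apply: ler_pM; rewrite ?powR_ge0//.
- by apply: ge0_ler_powR => //; rewrite ?nnegrE ?mulr_ge0// invr_ge0 ltW.
- by apply: ge0_ler_powR => //; rewrite ?nnegrE ?mulr_ge0// invr_ge0 ltW.
Qed.

(** The sum [G] is tested against [h = G `^ (p - 1) * l], which pairs with it to
    the integral [X] of [G `^ p * l]; the second embedding returns [X] itself,
    because [h `^ q * l `^ (1 - q) = G `^ p * l]. *)
Lemma finite_sparse_bound (p q Lam K1 K2 : R) (N : nat) (Q : nat -> set T)
    (s n U U' L L' F : nat -> R) (f u l : T -> R) :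
  (0 < p)%R -> (0 < q)%R -> (p^-1 + q^-1 = 1)%R -> (0 < Lam)%R ->
  (0 < K1)%R -> (0 < K2)%R ->
  nested_family N Q ->
  (forall i, (i < N)%N -> m (Q i) = (s i)%:E) ->
  (forall i, (i < N)%N -> 0 < s i)%R ->
  (forall j, (j < N)%N ->
     \sum_(j <= i < N) m (Q i `&` Q j) <= (Lam * s j)%:E) ->
  measurable_fun setT f -> measurable_fun setT u -> measurable_fun setT l ->
  (forall x, 0 <= f x)%R -> (forall x, 0 < u x)%R -> (forall x, 0 < l x)%R ->
  (forall i, (i < N)%N -> 0 < U i)%R -> (forall i, (i < N)%N -> 0 < U' i)%R ->
  (forall i, (i < N)%N -> 0 < L i)%R -> (forall i, (i < N)%N -> 0 < L' i)%R ->
  (forall i, (i < N)%N -> \int[m]_(x in Q i) (u x)%:E = (U i)%:E) ->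
  (forall i, (i < N)%N ->
    \int[m]_(x in Q i) (u x `^ (1 - q))%:E = (U' i)%:E) ->
  (forall i, (i < N)%N -> \int[m]_(x in Q i) (l x)%:E = (L i)%:E) ->
  (forall i, (i < N)%N ->
    \int[m]_(x in Q i) (l x `^ (1 - q))%:E = (L' i)%:E) ->
  (forall i, (i < N)%N -> U' i / s i * (U i / s i) `^ (q - 1) <= K1)%R ->
  (forall i, (i < N)%N -> L i / s i * (L' i / s i) `^ (p - 1) <= K2)%R ->
  (forall i, (i < N)%N -> 0 <= n i)%R ->
  (forall i, (i < N)%N ->
    \int[m]_(x in Q i) (u x `^ p^-1 * l x `^ (- p^-1))%:E = (n i)%:E) ->
  (forall i, (i < N)%N -> \int[m]_(x in Q i) (f x)%:E = (F i)%:E) ->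
  \int[m]_x ((\sum_(i < N) n i / s i * (F i / s i) * \1_(Q i) x) `^ p *
             l x)%:E <=
    ((Lam `^ (q + p - 2) * (p * q) * K1 * K2) `^ p)%:E *
    \int[m]_x (f x `^ p * u x)%:E.
Proof.
move=> p0 q0 pq Lam0 K1gt0 K2gt0 nQ mQs s0 carl mf mu ml f0 u0 l0 U0 U'0 L0 L'0.
move=> uQ u'Q lQ l'Q UK LK n0 nuQ fQ.
have K10 := ltW K1gt0; have K20 := ltW K2gt0; have mQ := nQ.1.
have qp : (q^-1 + p^-1 = 1)%R by rewrite addrC.
have mI i : measurable_fun setT (\1_(Q i) : T -> R) by exact: measurable_indic.
have F0 i : (i < N)%N -> (0 <= F i)%R.
  move=> iN; rewrite -lee_fin -fQ//.
  by apply: integral_ge0 => x _; rewrite lee_fin.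
pose c i := (n i / s i * (F i / s i))%R.
have c0 i : (i < N)%N -> (0 <= c i)%R.
  move=> iN; have si := ltW (s0 _ iN).
  by rewrite /c mulr_ge0 ?divr_ge0 ?n0 ?F0.
pose G x := (\sum_(i < N) c i * \1_(Q i) x)%R.
have G0 x : (0 <= G x)%R.
  by apply: sumr_ge0 => i _; rewrite mulr_ge0 ?c0// indicE.
have mG : measurable_fun setT G.
  by apply: measurable_sum => i; exact: measurable_funM.
have mGp r : measurable_fun setT (fun x => G x `^ r)%R.
  exact: measurableT_comp (measurable_powR _) mG.
pose B := (\sum_(i < N) c i)%R.
have GB x : (G x <= B)%R.
  by apply: ler_sum => i _; rewrite ler_piMr ?c0.
(* the extremal function of the pairing *)
pose h x := (G x `^ (p - 1) * l x)%R.
have h0 x : (0 <= h x)%R by rewrite mulr_ge0 ?powR_ge0// ltW.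
have mh : measurable_fun setT h by exact: measurable_funM.
have p1 : (0 <= p - 1)%R by rewrite subr_ge0 ltW// (conj_gt1 p0 q0 pq).
have hoo i : (i < N)%N -> \int[m]_(x in Q i) (h x)%:E < +oo.
  move=> iN; apply: (@le_lt_trans _ _ ((B `^ (p - 1))%:E * (L i)%:E)).
    have <- : \int[m]_(x in Q i) ((B `^ (p - 1))%:E * (l x)%:E) =
        (B `^ (p - 1))%:E * (L i)%:E.
      rewrite ge0_integralZl_EFin ?powR_ge0 ?lQ//.
      - by move=> x _; rewrite lee_fin ltW.
      - by apply: measurable_funTS; exact/measurable_EFinP.
    apply: ge0_le_integral => //.
    - by move=> x _; rewrite lee_fin.
    - by apply: measurable_funTS; exact/measurable_EFinP.
    - by apply: measurable_funTS; apply: measurable_funeM; exact/measurable_EFinP.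
    - move=> x _; rewrite -EFinM lee_fin ler_pM2r//.
      apply: ge0_ler_powR; rewrite ?nnegrE//.
      exact: le_trans (GB x).
  by rewrite -EFinM ltry.
pose H i := fine (\int[m]_(x in Q i) (h x)%:E).
have hQ i : (i < N)%N -> \int[m]_(x in Q i) (h x)%:E = (H i)%:E.
  move=> iN; rewrite fineK// ge0_fin_numE ?hoo//.
  by apply: integral_ge0 => x _; rewrite lee_fin.
have H0 i : (i < N)%N -> (0 <= H i)%R.
  by move=> iN; apply/fine_ge0/integral_ge0 => x _; rewrite lee_fin.
have XE : \int[m]_x (G x `^ p * l x)%:E = (\sum_(i < N) c i * H i)%:E.
  rewrite -sumEFin.
  under [RHS]eq_bigr => i _.
    rewrite EFinM -hQ// integral_setI1 -ge0_integralZl_EFin ?c0//; last 2 first.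
    - by move=> x _; rewrite lee_fin mulr_ge0 ?indicE.
    - by apply/measurable_EFinP; exact: measurable_funM.
    over.
  rewrite -ge0_integral_sum//; last 2 first.
  - by move=> i; apply: measurable_funeM; apply/measurable_EFinP;
      exact: measurable_funM.
  - by move=> i x _; rewrite -EFinM lee_fin mulr_ge0 ?c0// mulr_ge0 ?indicE.
  apply: eq_integral => x _; under eq_bigr do rewrite -EFinM.
  rewrite sumEFin; congr EFin; rewrite -(mulr_powRB1 (G0 x) p0) -mulrA -/(h x).
  by rewrite /G mulr_suml; apply: eq_bigr => i _; rewrite mulrAC -mulrA.
set X := (\sum_(i < N) c i * H i)%R in XE.
have X0 : (0 <= X)%R by apply: sumr_ge0 => i _; rewrite mulr_ge0 ?c0 ?H0.
have mu' : measurable_fun setT (fun x => u x `^ (1 - q))%R.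
  exact: measurableT_comp (measurable_powR _) mu.
have cqp : ((1 - q) * (1 - p) = 1)%R by have := conj_mulr p0 q0 pq; lra.
have u''E x : ((u x `^ (1 - q)) `^ (1 - p) = u x)%R.
  by rewrite -powRrM cqp powRr1// ltW.
pose A1 := (\sum_(i < N) U' i * (F i / U' i) `^ p)%R.
have emb1 : A1%:E <= (K1 * Lam `^ q * q `^ p)%:E *
    \int[m]_x (f x `^ p * u x)%:E.
  have := @carleson_embedding _ _ _ m p q Lam K1 N Q s U' U F f
    (fun x => u x `^ (1 - q))%R p0 q0 pq Lam0 K10 nQ mQs s0 carl mf mu' f0
    (fun x => powR_gt0 _ (u0 x)) U'0 U0 u'Q.
  move=> /(_ _ UK fQ) h1; apply: (le_trans (h1 _)).
    by move=> i iN; rewrite -uQ//; apply: eq_integral => x _; rewrite u''E.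
  rewrite le_eqVlt; apply/predU1P; left; congr (_ * _).
  by apply: eq_integral => x _; rewrite u''E.
pose A2 := (\sum_(i < N) L i * (H i / L i) `^ q)%R.
have emb2 : (A2 <= K2 * Lam `^ p * p `^ q * X)%R.
  rewrite -lee_fin [leRHS]EFinM -XE.
  have := @carleson_embedding _ _ _ m q p Lam K2 N Q s L L' H h l
    q0 p0 qp Lam0 K20 nQ mQs s0 carl mh ml h0 l0 L0 L'0 lQ l'Q LK hQ.
  move=> /le_trans; apply; rewrite le_eqVlt; apply/predU1P; left; congr (_ * _).
  apply: eq_integral => x _; congr EFin; rewrite /h powRM ?powR_ge0 ?(ltW (l0 x))//.
  rewrite -powRrM (conj_subr1M p0 q0 pq) -mulrA -powRD.
    by rewrite addrC subrK powRr1// ltW.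
  by apply/implyP => _; rewrite gt_eqF.
have A10 : (0 <= A1)%R.
  by apply: sumr_ge0 => i _; rewrite mulr_ge0 ?powR_ge0// ltW ?U'0.
have A20 : (0 <= A2)%R.
  by apply: sumr_ge0 => i _; rewrite mulr_ge0 ?powR_ge0// ltW ?L0.
have XA : (X <= K1 `^ q^-1 * K2 `^ p^-1 * (A1 `^ p^-1 * A2 `^ q^-1))%R.
  pose a i := (U' i `^ p^-1 * (F i / U' i))%R.
  pose b i := (L i `^ q^-1 * (H i / L i))%R.
  have a0 i : (i < N)%N -> (0 <= a i)%R.
    by move=> iN; rewrite mulr_ge0 ?powR_ge0// divr_ge0 ?F0// ltW// U'0.
  have b0 i : (i < N)%N -> (0 <= b i)%R.
    by move=> iN; rewrite mulr_ge0 ?powR_ge0// divr_ge0 ?H0// ltW// L0.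
  have := hoelder_sum p0 q0 pq a0 b0.
  have -> : (\sum_(i < N) a i `^ p = A1)%R.
    apply: eq_bigr => i _; rewrite /a powRM ?powR_ge0//.
      by rewrite powR_root// ltW// U'0.
    by rewrite divr_ge0 ?F0// ltW// U'0.
  have -> : (\sum_(i < N) b i `^ q = A2)%R.
    apply: eq_bigr => i _; rewrite /b powRM ?powR_ge0//.
      by rewrite powR_root// ltW// L0.
    by rewrite divr_ge0 ?H0// ltW// L0.
  move=> hab.
  have k0 : (0 <= K1 `^ q^-1 * K2 `^ p^-1)%R by rewrite mulr_ge0 ?powR_ge0.
  apply: le_trans (ler_wpM2l k0 hab).
  rewrite mulr_sumr; apply: ler_sum => i _.
  have iN := ltn_ord i.
  have ab0 : (0 <= (F i / U' i) * (H i / L i))%R.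
    by rewrite mulr_ge0 ?divr_ge0 ?F0 ?H0 ?(ltW (U'0 _ iN)) ?(ltW (L0 _ iN)).
  have nU : (n i <= U i `^ p^-1 * L' i `^ q^-1)%R.
    have := @integral_bloom_weight _ _ _ m u l p q (Q i) p0 q0 pq (mQ i) mu ml u0 l0.
    by rewrite nuQ// uQ// l'Q// !poweR_EFin -EFinM lee_fin.
  have := ler_wpM2r ab0 (two_weight_term p0 q0 pq (s0 _ iN) (U0 _ iN) (U'0 _ iN)
    (L0 _ iN) (L'0 _ iN) nU (UK _ iN) (LK _ iN)).
  have -> : (n i / s i * (U' i / s i) * L i * ((F i / U' i) * (H i / L i)) =
             c i * H i)%R.
    by rewrite /c; field; rewrite !gt_eqF ?s0 ?U'0 ?L0.
  move=> /le_trans; apply; rewrite /a /b le_eqVlt; apply/orP; left; apply/eqP.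
  by ring.
rewrite XE.
have Lamq : (0 <= K1 * Lam `^ q * q `^ p)%R by rewrite !mulr_ge0 ?powR_ge0.
have Lamp : (0 <= K2 * Lam `^ p * p `^ q)%R by rewrite !mulr_ge0 ?powR_ge0.
have CE : (K1 `^ q^-1 * K2 `^ p^-1 *
    ((K1 * Lam `^ q * q `^ p) `^ p^-1 * (K2 * Lam `^ p * p `^ q) `^ q^-1) =
    Lam `^ (q + p - 2) * (p * q) * K1 * K2)%R.
  rewrite !powRM ?mulr_ge0 ?powR_ge0// !powR_rootV ?(ltW p0) ?(ltW q0)//.
  have -> : ((Lam `^ q) `^ p^-1 = Lam `^ (q - 1))%R.
    rewrite -powRrM (_ : (q / p = q - 1)%R)//.
    by rewrite (conj_invr q0 pq) mulrC divfK// gt_eqF.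
  have -> : ((Lam `^ p) `^ q^-1 = Lam `^ (p - 1))%R.
    rewrite -powRrM (_ : (p / q = p - 1)%R)//.
    by rewrite (conj_invr p0 qp) mulrC divfK// gt_eqF.
  have -> : (Lam `^ (q + p - 2) = Lam `^ (q - 1) * Lam `^ (p - 1))%R.
    rewrite -powRD; first by congr powR; ring.
    by apply/implyP => _; rewrite gt_eqF.
  rewrite -[in RHS](powR_split pq K10) -[in RHS](powR_split pq K20).
  by ring.
rewrite -CE.
have : 0 <= \int[m]_x (f x `^ p * u x)%:E.
  by apply: integral_ge0 => x _; rewrite lee_fin mulr_ge0 ?powR_ge0// ltW.
set C := (_ * _)%R in CE *.
move: emb1; case: (\int[m]_x (f x `^ p * u x)%:E) => [Y||]// emb1 Y0; last first.
  rewrite mulry gtr0_sg ?mul1e ?leey// powR_gt0// CE.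
  by rewrite !mulr_gt0// powR_gt0.
apply: (@ereal_absorb _ p q p0 pq C X%:E Y%:E (Y%:E `^ p^-1 * X%:E `^ q^-1)) => //.
- by rewrite !mulr_ge0 ?powR_ge0.
- by rewrite ltry.
rewrite !poweR_EFin -!EFinM lee_fin.
rewrite lee_fin in Y0; rewrite -EFinM lee_fin in emb1.
by apply: (chain_powR p0 q0 _ A10 A20 Lamq Lamp Y0 X0 XA emb1 emb2);
  rewrite mulr_ge0 ?powR_ge0.
Qed.

End finite_families.

(** * Dyadic grids *)

Section cubes.
Context {R : realType}.
Local Open Scope ereal_scope.

Definition box n (a : 'I_n -> R) (b c : 'I_n -> bool) (l : R) :
    set (n.-tuple R) :=
  [set x | forall i, tnth x i \in
     Interval (BSide (b i) (a i)) (BSide (c i) (a i + l)%R)].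

Lemma measurable_box n a b c l : measurable (@box n a b c l).
Proof.
have -> : box a b c l = \bigcap_(i in [set: 'I_n]) ((fun x => tnth x i) @^-1`
    [set` Interval (BSide (b i) (a i)) (BSide (c i) (a i + l)%R)]).
  by apply/seteqP; split => [x xQ i _|x xQ i]; [exact: xQ|exact: xQ].
apply: fin_bigcap_measurable => //.
move=> i _; rewrite -[X in measurable X]setTI.
by apply: measurable_tnth => //; exact: measurable_itv.
Qed.

Lemma borel_lebesgue_box n a b c (l : R) : (0 < l)%R ->
  borel_lebesgue R n (box a b c l) = (l ^+ n)%:E.
Proof.
move=> l0; elim: n a b c => [|n ih] a b c.
  rewrite /= /dirac indicE mem_set ?expr0// => i; by case: i.
rewrite /= /lebesgue_step /pushforward.
have -> : @tuple_cons R n @^-1` box a b c l =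
    [set` Interval (BSide (b ord0) (a ord0)) (BSide (c ord0) (a ord0 + l)%R)] `*`
    box (fun i => a (lift ord0 i)) (fun i => b (lift ord0 i))
        (fun i => c (lift ord0 i)) l.
  apply/seteqP; split => -[z t].
    move=> H; split => /=; first by have := H ord0; rewrite tnth0.
    by move=> i; have := H (lift ord0 i); rewrite tnthS.
  move=> [/= z0 tQ] i; case: (unliftP ord0 i) => [j|] ->.
    by have := tQ j; rewrite tnthS.
  by rewrite tnth0.
rewrite product_measure1E//; last exact: measurable_box.
rewrite ih exprS EFinM; congr (_ * _).
have := lebesgue_measure_itv (Interval (BSide (b ord0) (a ord0))
  (BSide (c ord0) (a ord0 + l)%R)).
by rewrite /= lte_fin ltrDl l0 -EFinD addrAC subrr add0r.
Qed.

Lemma measurable_Rn n (A : set (n.-tuple R)) :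
  measurable A -> measurable (A : set (Rn R n)).
Proof. exact: caratheodory_measurable_mu_ext. Qed.

Lemma lebesgueE n (A : set (n.-tuple R)) : measurable A ->
  lebesgue (A : set (Rn R n)) = borel_lebesgue R n A.
Proof. exact: measurable_mu_extE. Qed.

Section cube.
Variables (n : nat) (l : R) (Q : set (Rn R n)).
Hypotheses (l0 : (0 < l)%R) (cQ : is_cube l Q).

Lemma measurable_cube : measurable Q.
Proof.
have [a [b [c ->]]] := cQ; exact: measurable_Rn (measurable_box a b c l).
Qed.

Lemma lebesgue_cube : lebesgue Q = (l ^+ n)%:E.
Proof.
have [a [b [c ->]]] := cQ.
by rewrite -(borel_lebesgue_box a b c l0) -lebesgueE//; exact: measurable_box.
Qed.

Definition rat_point (r : {ffun 'I_n -> rat}) : Rn R n :=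
  [tuple ratr (r i) | i < n].

Lemma cube_rat : exists r, Q (rat_point r).
Proof.
have [a [b [c ->]]] := cQ.
have /choice[r rP] : forall i : 'I_n, exists r : rat,
    ratr r \in `]a i, (a i + l)%R[.
  by move=> i; apply: rat_in_itvoo; rewrite ltrDl.
exists [ffun i => r i] => i.
have -> : Defs.coord (rat_point [ffun i => r i]) i = ratr (r i).
  by rewrite /Defs.coord /rat_point tnth_mktuple ffunE.
apply: subitvP (rP i).
by rewrite subitvE !bnd_simp; case: (b i); case: (c i); rewrite ?bnd_simp.
Qed.

End cube.
End cubes.

Section grid.
Context {R : realType} {n : nat} (D : set (set (Rn R n))).
Hypothesis hD : dyadic_grid D.
Local Open Scope ereal_scope.

Lemma grid_measurable Q : D Q -> measurable Q.
Proof.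
by case: hD => + _ _ => /[apply] -[k] /measurable_cube.
Qed.

Lemma grid_lebesgue Q : D Q -> exists2 s : R, (0 < s)%R & lebesgue Q = s%:E.
Proof.
case: hD => + _ _ => /[apply] -[k cQ].
exists ((2 ^ k) ^+ n)%R; first by rewrite exprn_gt0// exprz_gt0.
by apply: lebesgue_cube => //; rewrite exprz_gt0.
Qed.

(** Cubes of the same generation are disjoint, so a cube is determined by its
    generation and any of its rational points. *)
Lemma grid_countable : countable D.
Proof.
have /choice[kr krP] : forall Q, exists kr : int * {ffun 'I_n -> rat}, D Q ->
    is_cube (2 ^ kr.1) Q /\ Q (rat_point kr.2).
  move=> Q; have [DQ|nDQ] := pselect (D Q); last by exists (0%R, [ffun=> 0%R]).
  have [k cQ] : exists k : int, is_cube (2 ^ k) Q by case: hD => + _ _; apply.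
  have k0 : (0 < 2 ^ k :> R)%R by rewrite exprz_gt0.
  by have [r Qr] := cube_rat k0 cQ; exists (k, r).
apply/countable_injP; exists (pickle \o kr) => P Q; rewrite !inE => DP DQ /=.
move=> /(pcan_inj pickleK) PQ.
have [cP Pr] := krP _ DP; have [cQ Qr] := krP _ DQ; rewrite PQ in cP Pr.
have [_ /(_ (kr Q).1)[_ tD _] _] := hD.
by apply: tD; [split|split|exists (rat_point (kr Q).2)].
Qed.

Lemma grid_nonempty : exists Q, D Q.
Proof.
have [_ /(_ 0%R)[cD _ _] _] := hD.
have : [set: Rn R n] (rat_point [ffun=> 0%R]) by [].
by rewrite -cD => -[Q [DQ _] _]; exists Q.
Qed.

End grid.

(** * Densities and positive weights *)

Section densities.
Import HBNNSimple.
Context {d} {T : measurableType d} {R : realType}.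
Variables (m m' : {measure set T -> \bar R}) (g : T -> R).
Hypotheses (mg : measurable_fun setT g) (g0 : forall x, 0 <= g x).
Hypothesis gE : forall A, measurable A -> m' A = (\int[m]_(x in A) (g x)%:E)%E.
Local Open Scope ereal_scope.

Let density_nnsfun (h : {nnsfun T >-> R}) :
  \int[m']_x (h x)%:E = \int[m]_x (h x * g x)%:E.
Proof.
have mh y : measurable_fun setT (fun x => (g x * \1_(h @^-1` [set y]) x)%:E).
  by apply/measurable_EFinP; apply: measurable_funM.
rewrite integralT_nnsfun sintegralE fsbig_finite//=.
under eq_bigr do rewrite gE// integral_setI1.
transitivity (\int[m]_x \sum_(y <- finmap.enum_fset (fset_set (range h)))
    (`|y|%:E * (g x * \1_(h @^-1` [set y]) x)%:E)).
  rewrite ge0_integral_sum//; last 2 first.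
  - by move=> y; exact: measurable_funeM.
  - by move=> y x _; rewrite -EFinM lee_fin !mulr_ge0// indicE.
  apply: eq_big_seq => y; rewrite in_fset_set// inE => -[x _ <-].
  rewrite ger0_norm// ge0_integralZl_EFin//.
  by move=> z _; rewrite lee_fin mulr_ge0// indicE.
apply: eq_integral => x _; rewrite [in RHS]fimfunE fsbig_finite//= mulr_suml.
rewrite -sumEFin; apply: eq_big_seq => y; rewrite in_fset_set// inE => -[z _ <-].
by rewrite ger0_norm// -EFinM mulrAC mulrA.
Qed.

Lemma integral_density (f : T -> R) : measurable_fun setT f ->
  (forall x, 0 <= f x)%R ->
  \int[m']_x (f x)%:E = \int[m]_x (f x * g x)%:E.
Proof.
move=> mf f0; have mEf : measurable_fun setT (EFin \o f) by exact/measurable_EFinP.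
have Ef0 x : setT x -> 0 <= (EFin \o f) x by rewrite lee_fin.
pose h := nnsfun_approx measurableT mEf.
have hf x : EFin \o h ^~ x @ \oo --> (f x)%:E.
  exact: (cvg_nnsfun_approx measurableT mEf Ef0 (x := x) I).
have ndh x : {homo (fun k => h k x) : a b / (a <= b)%N >-> (a <= b)%R}.
  by move=> a b ab; exact/lefP/nd_nnsfun_approx.
transitivity (limn (fun k => \int[m']_x (h k x)%:E)).
  rewrite -monotone_convergence//.
  - by apply: eq_integral => x _; apply/esym/cvg_lim => //; exact: hf.
  - by move=> k; exact/measurable_EFinP.
  - by move=> k x _; rewrite lee_fin.
  - by move=> x _ a b ab; rewrite lee_fin ndh.
under eq_fun do rewrite density_nnsfun.
rewrite -monotone_convergence//.
- apply: eq_integral => x _; apply/cvg_lim => //.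
  under eq_fun do rewrite EFinM; rewrite EFinM.
  exact: cvgeZr (hf x).
- by move=> k; apply/measurable_EFinP; exact: measurable_funM.
- by move=> k x _; rewrite lee_fin mulr_ge0.
- by move=> x _ a b ab; rewrite lee_fin ler_wpM2r// ndh.
Qed.

End densities.

Section positivity.
Context {d} {T : measurableType d} {R : realType}.
Variable m : {measure set T -> \bar R}.
Local Open Scope ereal_scope.

Lemma integral_gt0 (f : T -> R) (A : set T) : measurable A -> 0 < m A ->
  measurable_fun setT f -> (forall x, 0 < f x)%R ->
  0 < \int[m]_(x in A) (f x)%:E.
Proof.
move=> mA A0 mf f0; rewrite lt0e; apply/andP; split; last first.
  by apply: integral_ge0 => x _; rewrite lee_fin ltW.
apply/eqP => If.
have mfA : measurable_fun A (EFin \o f).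
  by apply: measurable_funTS; exact/measurable_EFinP.
have [+ _] := ae_eq_integral_abs m mA mfA.
rewrite (eq_integral (EFin \o f)); last first.
  by move=> x _; rewrite gee0_abs// lee_fin ltW.
move=> /(_ If)[N [mN N0 subN]].
have : m A <= m N.
  apply: le_measure; rewrite ?inE// => x Ax; apply: subN => /= /(_ Ax) [].
  by apply/eqP; rewrite gt_eqF.
by rewrite N0 leNgt A0.
Qed.

Lemma integral_ae_eq (f g : T -> R) (A : set T) : measurable A ->
  measurable_fun setT f -> measurable_fun setT g ->
  {ae m, forall x, f x = g x} ->
  \int[m]_(x in A) (f x)%:E = \int[m]_(x in A) (g x)%:E.
Proof.
move=> mA mf mg fg; apply: ae_eq_integral => //.
- by apply: measurable_funTS; exact/measurable_EFinP.
- by apply: measurable_funTS; exact/measurable_EFinP.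
- by apply: filterS fg => x /= -> _.
Qed.

Lemma ge0_integrable (f : T -> R) (Q : set T) :
  measurable_fun setT f -> (forall x, 0 <= f x)%R ->
  \int[m]_(x in Q) (f x)%:E < +oo -> m.-integrable Q (EFin \o f).
Proof.
move=> mf f0 foo; apply/integrableP; split.
  by apply: measurable_funTS; exact/measurable_EFinP.
rewrite (eq_integral (fun x => (f x)%:E))// => x _.
by rewrite gee0_abs// lee_fin.
Qed.

(** A weight is positive almost everywhere only; changing it on a null set makes
    its negative powers behave everywhere. *)
Definition positive_version (w : T -> R) x : R := if (0 < w x)%R then w x else 1%R.

Lemma positive_version_gt0 w x : (0 < positive_version w x)%R.
Proof. by rewrite /positive_version; case: ifPn. Qed.

Lemma measurable_positive_version w : measurable_fun setT w ->
  measurable_fun setT (positive_version w).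
Proof.
move=> mw; apply: measurable_fun_ifT => //.
exact: measurable_fun_ltr.
Qed.

End positivity.

Section extended_powers.
Context {R : realType}.
Local Open Scope ereal_scope.

Lemma ereal_sup_poweR (A : set (\bar R)) (r : R) : (0 < r)%R ->
  A !=set0 -> (forall x, A x -> 0 <= x) ->
  ereal_sup [set x `^ r | x in A] = ereal_sup A `^ r.
Proof.
move=> r0 [a Aa] A0.
have le0 (B : set \bar R) y : B y -> 0 <= y -> 0 <= ereal_sup B.
  by move=> By y0; apply: le_trans y0 _; exact: ereal_sup_ubound.
have s0 := le0 _ _ Aa (A0 _ Aa).
have s0' : 0 <= ereal_sup [set x `^ r | x in A].
  by apply: (le0 _ (a `^ r)); [exists a|exact: poweR_ge0].
have rV0 : (0 <= r^-1)%R by rewrite invr_ge0 ltW.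
apply/eqP; rewrite eq_le; apply/andP; split.
  apply: ge_ereal_sup => _ [x Ax <-]; apply: gt0_ler_poweR; first exact: ltW.
  - by rewrite in_itv/= leey A0.
  - by rewrite in_itv/= leey s0.
  - exact: ereal_sup_ubound.
have -> : ereal_sup [set x `^ r | x in A] =
    (ereal_sup [set x `^ r | x in A] `^ r^-1) `^ r.
  by rewrite -poweRrM mulVf ?gt_eqF// poweRe1.
apply: gt0_ler_poweR; first exact: ltW.
- by rewrite in_itv/= leey s0.
- by rewrite in_itv/= leey poweR_ge0.
apply: ge_ereal_sup => x Ax.
have -> : x = (x `^ r) `^ r^-1.
  by rewrite -poweRrM mulfV ?gt_eqF// poweRe1// A0.
apply: gt0_ler_poweR => //.
- by rewrite in_itv/= leey poweR_ge0.
- by rewrite in_itv/= leey s0'.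
- by apply: ereal_sup_ubound; exists x.
Qed.

Lemma ereal_pos_real (x : \bar R) :
  (0 < x -> x < +oo -> exists2 K : R, (0 < K)%R & x = K%:E)%E.
Proof. by case: x => [K||]//; exists K. Qed.

Lemma EFin_mul_lty (k : R) (x : \bar R) :
  (0 <= k)%R -> (x < +oo -> k%:E * x < +oo)%E.
Proof. by move=> k0 xoo; rewrite lte_mul_pinfty. Qed.

Lemma le_poweR_root (p C : R) (x y : \bar R) : (0 < p)%R ->
  (0 <= C)%R -> (0 <= x -> 0 <= y -> y <= 1 ->
  x `^ p <= (C `^ p)%:E * y `^ p -> x <= C%:E)%E.
Proof.
move=> p0 C0 x0 y0 y1 xy; have pn0 : (p != 0)%R by rewrite gt_eqF.
have root (z : \bar R) : (0 <= z -> z = (z `^ p) `^ p^-1)%E.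
  by move=> z0; rewrite -poweRrM mulfV// poweRe1.
have le_pow (a b : \bar R) (r : R) : (0 <= r)%R -> (0 <= a -> a <= b ->
    a `^ r <= b `^ r)%E.
  move=> r0 a0 ab; apply: gt0_ler_poweR; rewrite ?in_itv/= ?leey ?andbT//.
  exact: le_trans ab.
rewrite (root x)// (root C%:E) ?lee_fin//.
apply: (le_pow); [by rewrite invr_ge0 ltW|exact: poweR_ge0|].
apply: (le_trans xy); rewrite poweR_EFin -[leRHS]mule1.
apply: lee_wpmul2l; first by rewrite lee_fin powR_ge0.
by rewrite -(poweR1r p); apply: le_pow => //; exact: ltW.
Qed.

End extended_powers.

(** * Muckenhoupt classes *)

Section conjugate_exponent.
Context {R : realType} (p : R).
Hypothesis p1 : 1 < p.

Lemma conj_expE : conj_exp p = p / (p - 1).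
Proof.
have pn0 : p != 0 by rewrite gt_eqF// (lt_trans _ p1).
have p1n0 : p - 1 != 0 by rewrite subr_eq0 gt_eqF.
rewrite /conj_exp /hoelder_conjugate /= eqe (negbTE pn0) -EFinD inver.
by rewrite (negbTE p1n0) -EFinM.
Qed.

Lemma conj_exp_gt0 : 0 < conj_exp p.
Proof. by rewrite conj_expE divr_gt0 ?subr_gt0// (lt_trans _ p1). Qed.

Lemma conj_exp_sum : p^-1 + (conj_exp p)^-1 = 1.
Proof.
have pn0 : p != 0 by rewrite gt_eqF// (lt_trans _ p1).
by rewrite conj_expE invf_div mulrBl mulfV// mul1r addrC subrK.
Qed.

Lemma conj_exp_gt1 : 1 < conj_exp p.
Proof.
have p0 : 0 < p by rewrite (lt_trans _ p1).
by apply: (conj_gt1 conj_exp_gt0 p0); rewrite addrC conj_exp_sum.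
Qed.

Lemma conj_exp_subr1 : conj_exp p - 1 = (p - 1)^-1.
Proof.
have p1n0 : p - 1 != 0 by rewrite subr_eq0 gt_eqF.
by rewrite conj_expE -[X in _ - X](mulfV p1n0) -mulrBl opprB addrC subrK mul1r.
Qed.

End conjugate_exponent.

Lemma conj_expK {R : realType} (p : R) : 1 < p -> conj_exp (conj_exp p) = p.
Proof.
move=> p1; rewrite (conj_expE (conj_exp_gt1 p1)) conj_exp_subr1// invrK.
by rewrite conj_expE// divfK// subr_eq0 gt_eqF.
Qed.

Section Ap_weights.
Context {R : realType} {n : nat} (D : set (set (Rn R n))).
Hypothesis hD : dyadic_grid D.
Local Notation T := (Rn R n).
Local Open Scope ereal_scope.

Lemma average_ae_eq (f g : T -> R) Q : measurable Q ->
  measurable_fun setT f -> measurable_fun setT g ->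
  {ae lebesgue, forall x, f x = g x} -> average f Q = average g Q.
Proof.
move=> mQ mf mg fg.
exact: (congr1 _ (integral_ae_eq mQ mf mg fg)).
Qed.

Lemma average_ge0 (f : T -> R) Q : (forall x, 0 <= f x)%R -> 0 <= average f Q.
Proof.
move=> f0; rewrite /average mule_ge0 ?lee_fin ?invr_ge0 ?fine_ge0//.
by apply: integral_ge0 => x _; rewrite lee_fin.
Qed.

Lemma measurable_conj_weight (p : R) (w : T -> R) : measurable_fun setT w ->
  measurable_fun setT (conj_weight p w).
Proof. by move=> mw; exact: measurableT_comp (measurable_powR _) mw. Qed.

Lemma conj_weight_gt0 (p : R) (w : T -> R) x : (0 < w x)%R ->
  (0 < conj_weight p w x)%R.
Proof. exact: powR_gt0. Qed.

Lemma conj_weightK (p : R) (w : T -> R) : (1 < p)%R -> (forall x, 0 < w x)%R ->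
  conj_weight (conj_exp p) (conj_weight p w) = w.
Proof.
move=> p1 w0; apply/funext => x; rewrite /conj_weight conj_expK// -powRrM.
have p0 : (0 < p)%R by rewrite (lt_trans _ p1).
have := conj_mulr p0 (conj_exp_gt0 p1) (conj_exp_sum p1) => pq.
by rewrite (_ : (_ * _ = 1)%R) ?powRr1 ?ltW//; lra.
Qed.

Lemma Ap_const_ae_eq (p : R) (f g : T -> R) :
  measurable_fun setT f -> measurable_fun setT g ->
  {ae lebesgue, forall x, f x = g x} -> Ap_const D p f = Ap_const D p g.
Proof.
move=> mf mg fg; apply: (congr1 (@ereal_sup R)).
apply: eq_imagel => Q DQ; have mQ := grid_measurable hD DQ.
have fg' : {ae lebesgue, forall x, conj_weight p f x = conj_weight p g x}.
  by apply: filterS fg => x fgx; rewrite /conj_weight fgx.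
apply: (f_equal2 (fun a b => a * b `^ (p - 1))).
  exact: average_ae_eq mQ mf mg fg.
exact: (average_ae_eq mQ (measurable_conj_weight p mf)
  (measurable_conj_weight p mg) fg').
Qed.

(** Each quotient of the class of [conj_weight p w] is the power [(p - 1)^-1] of
    the quotient of [w] on the same cube. *)
Lemma Ap_const_conj (p : R) (w : T -> R) : (1 < p)%R -> (forall x, 0 < w x)%R ->
  Ap_const D (conj_exp p) (conj_weight p w) = Ap_const D p w `^ (p - 1)^-1.
Proof.
move=> p1 w0; rewrite /Ap_const -ereal_sup_poweR; last 3 first.
- by rewrite invr_gt0 subr_gt0.
- by have [Q DQ] := grid_nonempty hD; eexists; exists Q.
- move=> _ [Q DQ <-]; rewrite mule_ge0 ?poweR_ge0// average_ge0// => x.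
  exact: ltW.
rewrite image_comp; apply: (congr1 (@ereal_sup R)); apply: eq_imagel => Q DQ /=.
rewrite conj_weightK// conj_exp_subr1// poweRM ?poweR_ge0//; last first.
  by apply: average_ge0 => x; exact: ltW.
rewrite -poweRrM mulfV ?subr_eq0 ?gt_eqF// poweRe1 1?muleC//.
by apply: average_ge0 => x; rewrite ltW// conj_weight_gt0.
Qed.

(** The averages of a weight and of its conjugate are both positive, so neither
    can be infinite when their product is finite. *)
Lemma Ap_integrals (p : R) (w : T -> R) (K : R) Q : (1 < p)%R ->
  measurable_fun setT w -> (forall x, 0 < w x)%R ->
  Ap_const D p w = K%:E -> D Q ->
  [/\ 0 < lebesgue Q < +oo,
      0 < \int[lebesgue]_(x in Q) (w x)%:E < +oo,
      0 < \int[lebesgue]_(x in Q) (w x `^ (1 - conj_exp p))%:E < +oo &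
      (fine (\int[lebesgue]_(x in Q) (w x)%:E) / fine (lebesgue Q) *
       (fine (\int[lebesgue]_(x in Q) (w x `^ (1 - conj_exp p))%:E) /
         fine (lebesgue Q)) `^ (p - 1) <= K)%R].
Proof.
move=> p1 mw w0 wK DQ; have mQ := grid_measurable hD DQ.
have [s s0 Qs] := grid_lebesgue hD DQ.
have : average w Q * average (conj_weight p w) Q `^ (p - 1) <= K%:E.
  by rewrite -wK; apply: ereal_sup_ubound; exists Q.
rewrite /average Qs /= -/(conj_weight p w).
have Q0 : 0 < lebesgue Q by rewrite Qs lte_fin.
have := integral_gt0 mQ Q0 mw w0.
have := integral_gt0 mQ Q0 (measurable_conj_weight p mw)
  (fun x => conj_weight_gt0 p (w0 x)).
have sV0 : 0 < (s^-1)%:E by rewrite lte_fin invr_gt0.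
have p10 : (p - 1 != 0)%R by rewrite subr_eq0 gt_eqF.
rewrite /conj_weight.
case: (\int[_]_(x in Q) (w x `^ _)%:E) => [V||]//;
  case: (\int[_]_(x in Q) (w x)%:E) => [W||]// V0 W0.
- rewrite -!EFinM lee_fin => h.
  by rewrite V0 W0 !ltry lte_fin s0; split=> //=; rewrite ![(_ / s)%R]mulrC.
- by rewrite (gt0_muley sV0) gt0_mulye// poweR_gt0// mule_gt0.
- by rewrite (gt0_muley sV0) poweRyr// gt0_muley// mule_gt0.
- by rewrite (gt0_muley sV0) poweRyr// gt0_muley.
Qed.

Lemma Ap_const_gt0 (p : R) (w : T -> R) : (1 < p)%R ->
  measurable_fun setT w -> (forall x, 0 < w x)%R -> 0 < Ap_const D p w.
Proof.
move=> p1 mw w0; have [Q DQ] := grid_nonempty hD.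
have mQ := grid_measurable hD DQ.
have [s s0 Qs] := grid_lebesgue hD DQ.
have Q0 : 0 < lebesgue Q by rewrite Qs lte_fin.
apply: (@lt_le_trans _ _
    (average w Q * average (conj_weight p w) Q `^ (p - 1))).
  have sV0 : 0 < (s^-1)%:E by rewrite lte_fin invr_gt0.
  rewrite /average Qs /=; apply: mule_gt0.
    exact: (mule_gt0 sV0 (integral_gt0 mQ Q0 mw w0)).
  apply: poweR_gt0; apply: (mule_gt0 sV0).
  exact: (integral_gt0 mQ Q0 (measurable_conj_weight p mw)
    (fun x => conj_weight_gt0 p (w0 x))).
by apply: ereal_sup_ubound; exists Q.
Qed.

End Ap_weights.

(** * From finite to countable families *)

Section countable_families.
Context {d} {T : measurableType d} {R : realType}.
Variables (m : {measure set T -> \bar R}) (S : set (set T)).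
Hypotheses (cS : countable S) (mS : forall Q, S Q -> measurable Q).
Local Open Scope ereal_scope.

Lemma countable_enum : exists (P : set nat) (e : nat -> set T), set_bij P S e.
Proof.
have /countable_bijP[P /card_esym/card_set_bijP[e Pe]] := cS.
by exists P, e.
Qed.

Lemma measurable_esum_indic (a : set T -> R) : (forall Q, 0 <= a Q)%R ->
  measurable_fun setT (fun x => \esum_(Q in S) (a Q * \1_Q x)%:E).
Proof.
move=> a0; have [P [e [Pe inje surje]]] := countable_enum.
have -> : (fun x => \esum_(Q in S) (a Q * \1_Q x)%:E) =
    (fun x => \sum_(i <oo | i \in P) (a (e i) * \1_(e i) x)%:E).
  apply/funext => x; rewrite nneseries_esum ?set_mem_set.
    by rewrite (@reindex_esum R _ _ P S e).
  by move=> i _; rewrite lee_fin mulr_ge0// indicE.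
apply: ge0_emeasurable_sum => [i x _ _|i].
  by rewrite lee_fin mulr_ge0// indicE.
rewrite inE => Pi; apply/measurable_EFinP; apply: measurable_funM => //.
by apply: measurable_indic; apply: mS; exact: Pe.
Qed.

Section limit.
Variables (c : set T -> R) (l : T -> R) (p B : R).
Hypotheses (c0 : forall Q, (0 <= c Q)%R) (ml : measurable_fun setT l).
Hypotheses (l0 : forall x, (0 < l x)%R) (p0 : (0 < p)%R).
Hypothesis finite_bound : forall X : seq (set T),
  uniq X -> (forall Q, Q \in X -> S Q) ->
  \int[m]_x ((\sum_(Q <- X) c Q * \1_Q x) `^ p * l x)%:E <= B%:E.

(** A bound for the finite subfamilies passes to the whole family by monotone
    convergence along an enumeration.  The limit [L] of the integrands is
    compared with the sum of the family through the last inequality, which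
    avoids taking the power function to the limit. *)
Lemma countable_limit : exists L : T -> \bar R,
  [/\ measurable_fun setT L, forall x, 0 <= L x, \int[m]_x L x <= B%:E &
      forall x r, L x <= r%:E -> \esum_(Q in S) (c Q * \1_Q x)%:E <=
        ((r / l x) `^ p^-1)%:E].
Proof.
have [P [e [Pe inje surje]]] := countable_enum.
pose h k x : R := (\sum_(0 <= i < k | i \in P) c (e i) * \1_(e i) x)%R.
have ci0 i x : (0 <= c (e i) * \1_(e i) x)%R by rewrite mulr_ge0// indicE.
have h0 k x : (0 <= h k x)%R by exact: sumr_ge0.
have ndh x : {homo (fun k => h k x) : a b / (a <= b)%N >-> (a <= b)%R}.
  move=> a b ab; rewrite /h (big_cat_nat _ ab)//= lerDl.
  exact: sumr_ge0.
have mh k : measurable_fun setT (h k).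
  have -> : h k = (fun x => \sum_(i <- [seq i <- index_iota 0 k | i \in P])
      c (e i) * \1_(e i) x)%R by apply/funext => x; rewrite big_filter.
  have : all (mem P) [seq i <- index_iota 0 k | i \in P] by exact: filter_all.
  elim: [seq _ <- _ | _] => [_|i s ih /= /andP[Pi Ps]].
    by under eq_fun do rewrite big_nil; exact: measurable_cst.
  under eq_fun do rewrite big_cons; apply: measurable_funD; last exact: ih.
  apply: measurable_funM => //; apply: measurable_indic; apply: mS; apply: Pe.
  by rewrite inE in Pi.
pose g k x := (h k x `^ p * l x)%:E.
have ndg x : {homo (fun k => g k x) : a b / (a <= b)%N >-> a <= b}.
  move=> a b ab; rewrite lee_fin ler_pM2r//.
  apply: ge0_ler_powR; rewrite ?nnegrE ?h0 ?ndh//; exact: ltW.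
have mg k : measurable_fun setT (g k).
  apply/measurable_EFinP; apply: measurable_funM => //.
  exact: measurableT_comp (measurable_powR _) (mh k).
have g0 k x : 0 <= g k x by rewrite lee_fin mulr_ge0 ?powR_ge0// ltW.
have cvgg x : cvgn (g ^~ x) by exact: ereal_nondecreasing_is_cvgn.
have gL k x : g k x <= limn (g ^~ x).
  rewrite (cvg_lim _ (ereal_nondecreasing_cvgn (ndg x)))//.
  by apply: ereal_sup_ubound; exists k.
exists (fun x => limn (g ^~ x)); split.
- exact: (@emeasurable_fun_cvg _ T R setT g _ mg (fun x _ => cvgg x)).
- by move=> x; exact: le_trans (g0 0%N x) (gL 0%N x).
- rewrite (monotone_convergence m measurableT mg (fun k x _ => g0 k x)
    (fun x _ => ndg x)).
  apply: lime_le.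
    apply: ereal_nondecreasing_is_cvgn => a b ab; apply: ge0_le_integral => //.
    by move=> x _; exact: ndg.
  apply: nearW => k.
  have := @finite_bound [seq e i | i <- [seq i <- index_iota 0 k | i \in P]].
  have -> : uniq [seq e i | i <- [seq i <- index_iota 0 k | i \in P]].
    rewrite map_inj_in_uniq ?filter_uniq ?iota_uniq// => i j.
    by rewrite !mem_filter => /andP[Pi _] /andP[Pj _]; exact: inje.
  move=> /(_ isT); under eq_integral do rewrite big_map big_filter.
  apply => Q /mapP[i]; rewrite mem_filter => /andP[Pi _] ->.
  by apply: Pe; rewrite inE in Pi.
- move=> x r Lr; rewrite (@reindex_esum R _ _ P S e)//.
  rewrite -[in leLHS](set_mem_set P) -nneseries_esum; last first.
    by move=> i _; rewrite lee_fin.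
  apply: lime_le.
    by apply: is_cvg_nneseries_cond => i _ _; rewrite lee_fin.
  apply: nearW => k; rewrite sumEFin lee_fin -/(h k x).
  rewrite -[leLHS](powR_rootV p0)//.
  have hr : (h k x `^ p <= r / l x)%R.
    by rewrite ler_pdivlMr// -lee_fin; exact: le_trans (gL k x) Lr.
  apply: ge0_ler_powR; rewrite ?nnegrE ?powR_ge0 ?invr_ge0 ?(ltW p0)//.
  exact: le_trans (powR_ge0 _ _) hr.
Qed.

Lemma ae_esum_fin :
  {ae m, forall x, \esum_(Q in S) (c Q * \1_Q x)%:E < +oo}.
Proof.
have [L [mL L0 LB HL]] := countable_limit.
have iL : m.-integrable setT L.
  apply/integrableP; split => //.
  under eq_integral do rewrite gee0_abs//.
  exact: le_lt_trans LB (ltry _).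
apply: filterS (integrable_ae measurableT iL) => x /(_ I) Lx.
apply: (@le_lt_trans _ _ ((fine (L x) / l x) `^ p^-1)%:E); last exact: ltry.
by apply: HL; rewrite fineK.
Qed.

Lemma esum_dominated_integral (h : T -> R) : measurable_fun setT h ->
  (forall x, `|h x|%:E <= \esum_(Q in S) (c Q * \1_Q x)%:E) ->
  \int[m]_x (`|h x| `^ p * l x)%:E <= B%:E.
Proof.
move=> mh hH; have [L [mL L0 LB HL]] := countable_limit.
apply: le_trans LB; apply: ge0_le_integral => //.
- by move=> x _; rewrite lee_fin mulr_ge0 ?powR_ge0// ltW.
- apply/measurable_EFinP; apply: measurable_funM => //.
  apply: measurableT_comp (measurable_powR _) _.
  exact: measurableT_comp.
- move=> x _; case Lx: (L x) => [r||]; last 2 first.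
  + by rewrite leey.
  + by have := L0 x; rewrite Lx.
  have := le_trans (hH x) (HL x r _); rewrite Lx lexx lee_fin => /(_ isT) h1.
  have r0 : (0 <= r)%R by rewrite -lee_fin -Lx.
  rewrite lee_fin -ler_pdivlMr// -[leRHS](powR_root p0).
    by apply: ge0_ler_powR; rewrite ?nnegrE ?powR_ge0// ltW.
  by rewrite divr_ge0// ltW.
Qed.

End limit.
End countable_families.

(** * The sparse operator on a grid *)

Section local_integrability.
Context {R : realType} {n : nat} (D : set (set (Rn R n))).
Hypotheses (hD : dyadic_grid D).
Local Notation T := (Rn R n).
Local Open Scope ereal_scope.
Variables (p K1 K2 : R) (u l : T -> R).
Let q := conj_exp p.
Hypotheses (p1 : (1 < p)%R).
Hypotheses (mu : measurable_fun setT u) (ml : measurable_fun setT l).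
Hypotheses (u0 : forall x, (0 < u x)%R) (l0 : forall x, (0 < l x)%R).
Hypotheses (K1E : Ap_const D q (conj_weight p u) = K1%:E).
Hypotheses (K2E : Ap_const D p l = K2%:E).

Let p0 : (0 < p)%R. Proof. by rewrite (lt_trans _ p1). Qed.
Let q0 : (0 < q)%R. Proof. exact: conj_exp_gt0 p1. Qed.
Let pq : (p^-1 + q^-1 = 1)%R. Proof. exact: conj_exp_sum p1. Qed.

Lemma conj_weight_powR x : (conj_weight p u x `^ (1 - p) = u x)%R.
Proof.
by rewrite -[in RHS](conj_weightK p1 u0) {2}/conj_weight conj_expK.
Qed.

Lemma Ap_conj_integrals Q : D Q ->
  [/\ 0 < \int[lebesgue]_(x in Q) (u x)%:E < +oo,
      0 < \int[lebesgue]_(x in Q) (u x `^ (1 - q))%:E < +oo &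
      (fine (\int[lebesgue]_(x in Q) (u x `^ (1 - q))%:E) / fine (lebesgue Q) *
       (fine (\int[lebesgue]_(x in Q) (u x)%:E) / fine (lebesgue Q)) `^ (q - 1)
         <= K1)%R].
Proof.
move=> DQ; have mu' : measurable_fun setT (conj_weight p u).
  exact: measurable_conj_weight.
have [_] := Ap_integrals hD (conj_exp_gt1 p1) mu'
  (fun x => conj_weight_gt0 p (u0 x)) K1E DQ.
rewrite (conj_expK p1).
have -> : (fun x => (conj_weight p u x `^ (1 - p))%:E) = (fun x => (u x)%:E).
  by apply/funext => x; rewrite conj_weight_powR.
by [].
Qed.

Lemma bloom_weight_lty Q : D Q ->
  \int[lebesgue]_(x in Q) (bloom_weight p u l x)%:E < +oo.
Proof.
move=> DQ; have mQ := grid_measurable hD DQ.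
have := integral_bloom_weight lebesgue p0 q0 pq mQ mu ml u0 l0.
move=> /le_lt_trans; apply.
have [/andP[_ U] _ _] := Ap_conj_integrals DQ.
have [_ _ /andP[_ L] _] := Ap_integrals hD p1 ml l0 K2E DQ.
apply: lte_mul_pinfty; first exact: poweR_ge0.
  by rewrite ge0_fin_numE ?poweR_ge0// poweR_lty.
exact: poweR_lty.
Qed.

Lemma Lp_integral_lty (f : T -> R) Q : measurable_fun setT f ->
  (forall x, 0 <= f x)%R -> \int[lebesgue]_x (f x `^ p * u x)%:E < +oo ->
  D Q -> \int[lebesgue]_(x in Q) (f x)%:E < +oo.
Proof.
move=> mf f0 foo DQ; have mQ := grid_measurable hD DQ.
have mu' : measurable_fun setT (conj_weight p u).
  exact: measurable_conj_weight.
have mI : measurable_fun setT (\1_Q : T -> R) by exact: measurable_indic.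
have I0 x : (0 <= \1_Q x :> R)%R by rewrite indicE.
have := weighted_hoelder lebesgue mf mI mu' f0 I0
  (fun x => conj_weight_gt0 p (u0 x)) p0 q0 pq.
rewrite (integral_setI1 lebesgue f Q) => /le_lt_trans; apply.
have -> : (fun x => (f x `^ p * conj_weight p u x `^ (1 - p))%:E) =
    (fun x => (f x `^ p * u x)%:E).
  by apply/funext => x; rewrite conj_weight_powR.
have -> : \int[lebesgue]_x (\1_Q x `^ q * conj_weight p u x)%:E =
    \int[lebesgue]_(x in Q) (u x `^ (1 - q))%:E.
  rewrite [RHS]integral_setI1; apply: eq_integral => x _; congr EFin.
  rewrite indicE; case: (x \in Q); first by rewrite powR1 mul1r mulr1.
  by rewrite powR0 ?gt_eqF// mul0r mulr0.
have [_ /andP[_ U] _] := Ap_conj_integrals DQ.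
apply: lte_mul_pinfty; first exact: poweR_ge0.
  by rewrite ge0_fin_numE ?poweR_ge0// poweR_lty.
exact: poweR_lty.
Qed.

End local_integrability.

Section sparse_families.
Context {R : realType} {n : nat} (D S : set (set (Rn R n))) (Lam : R).
Hypotheses (n0 : (0 < n)%N) (hD : dyadic_grid D) (SD : S `<=` D).
Hypotheses (Lam0 : 0 < Lam) (hS : Carleson D S Lam).
Local Notation T := (Rn R n).
Local Open Scope ereal_scope.

(** Two cubes of equal measure have the same side, hence belong to the same
    partition of the space. *)
Lemma grid_subset_eq P Q : D P -> D Q -> P `<=` Q ->
  lebesgue P = lebesgue Q -> P = Q.
Proof.
move=> DP DQ PQ.
have [cube part _] := hD.
have [k cP] := cube _ DP; have [j cQ] := cube _ DQ.
have k0 : (0 < 2 ^ k :> R)%R by rewrite exprz_gt0.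
have j0 : (0 < 2 ^ j :> R)%R by rewrite exprz_gt0.
rewrite (lebesgue_cube k0 cP) (lebesgue_cube j0 cQ) => -[] /(pexpIrn n0).
rewrite !nnegrE (ltW k0) (ltW j0) => /(_ isT isT) kj.
have [r Pr] := cube_rat k0 cP.
have [_ tD _] := part k; rewrite -kj in cQ.
by apply: tD; [split|split|exists (rat_point r); split => //; exact: PQ].
Qed.

Definition larger_first (P Q : set T) : bool :=
  (fine (lebesgue Q) <= fine (lebesgue P))%R.

Section finite_subfamily.
Variables (X : seq (set T)).
Hypotheses (uX : uniq X) (XS : forall Q, Q \in X -> S Q).

Let Y := sort larger_first X.
Let Q i := nth set0 Y i.
Let N := size Y.

Let SY i : (i < N)%N -> S (Q i).
Proof. by move=> iN; apply: XS; rewrite -(mem_sort larger_first) mem_nth. Qed.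

Let DY i : (i < N)%N -> D (Q i).
Proof. by move=> /SY; exact: SD. Qed.

Let lebY i : (i < N)%N -> exists2 s : R, (0 < s)%R & lebesgue (Q i) = s%:E.
Proof. by move=> iN; exact: (grid_lebesgue hD (DY iN)). Qed.

(** Sorting by measure puts the larger cubes first; a cube contained in a later
    one has the same measure, hence equals it. *)
Lemma sorted_nested : nested_family N Q.
Proof.
split=> [i|i j /andP[ij jN]].
  have [iN|Ni] := ltnP i N; first exact: (grid_measurable hD (DY iN)).
  by rewrite /Q nth_default.
have iN := ltn_trans ij jN.
have [_ _ /(_ _ _ (DY iN) (DY jN))] := hD.
case=> [QQ|[QQ|]]; [left|left|by right].
- suff -> : Q i = Q j by [].
  have sub : Q i `<=` Q j by rewrite -QQ => x [].
  apply: (grid_subset_eq (DY iN) (DY jN) sub).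
  have mi := grid_measurable hD (DY iN); have mj := grid_measurable hD (DY jN).
  have le : lebesgue (Q i) <= lebesgue (Q j).
    by apply: le_measure; rewrite ?inE//; exact: sub.
  have : larger_first (Q i) (Q j).
    apply: (sorted_leq_nth (leT := larger_first)) => //.
    - by move=> A B C BA CA; exact: le_trans CA BA.
    - by move=> A; exact: lexx.
    - by apply: sort_sorted => A B; exact: le_total.
    - exact: ltnW.
  rewrite /larger_first; move: le.
  have [s _ ->] := lebY iN; have [t _ ->] := lebY jN.
  by rewrite lee_fin /= => st ts; congr EFin; apply/eqP; rewrite eq_le st ts.
- by rewrite -QQ => x [].
Qed.

(** The cubes that come after [Q j] and meet it are contained in it, so their
    measures are among those of the Carleson condition. *)
Lemma sorted_carleson j : (j < N)%N ->
  \sum_(j <= i < N) lebesgue (Q i `&` Q j) <=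
  (Lam * fine (lebesgue (Q j)))%:E.
Proof.
move=> jN; have DQ := DY jN.
have [s s0 Qs] := lebY jN; rewrite Qs /= EFinM -Qs.
apply: le_trans (hS DQ).
pose F (P : set T) : \bar R := if `[< P `<=` Q j >] then lebesgue P else 0.
have F0 P : 0 <= F P by rewrite /F; case: ifP.
apply: (@le_trans _ _ (\sum_(j <= i < N) F (Q i))).
  rewrite big_nat [leRHS]big_nat; apply: lee_sum => i /andP[ji iN].
  rewrite /F; case: asboolP => [QQ|nQQ]; first by rewrite setIidl.
  have [ij|ij] := eqVneq i j; first by case: nQQ; rewrite ij.
  have {}ji : (j < i)%N by rewrite ltn_neqAle eq_sym ij.
  have [_ nQ] := sorted_nested.
  have [|//|QQ] := nQ j i; first by rewrite ji.
  by rewrite setIC QQ measure0.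
apply: (@le_trans _ _ (\sum_(0 <= i < N) F (Q i))).
  rewrite [leRHS](big_cat_nat (n := j))//=; last exact: ltnW.
  by rewrite leeDr// sume_ge0.
rewrite -(big_nth set0 xpredT F) -big_mkcond -big_filter.
apply: esum_ge; exists [set` [seq P <- Y | `[< P `<=` Q j >]]].
  split; first exact: finite_seq.
  move=> P /=; rewrite mem_filter => /andP[/asboolP PQ].
  by rewrite mem_sort => /XS.
by rewrite -fsbig_seq// filter_uniq// sort_uniq.
Qed.

Section bound.
Variables (p K1 K2 : R) (u l f : T -> R).
Let q := conj_exp p.
Hypotheses (p1 : (1 < p)%R).
Hypotheses (mu : measurable_fun setT u) (ml : measurable_fun setT l).
Hypotheses (u0 : forall x, (0 < u x)%R) (l0 : forall x, (0 < l x)%R).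
Hypotheses (K1E : Ap_const D q (conj_weight p u) = K1%:E).
Hypotheses (K2E : Ap_const D p l = K2%:E).
Hypotheses (mf : measurable_fun setT f) (f0 : forall x, (0 <= f x)%R).
Hypothesis fS : forall P, S P -> \int[lebesgue]_(x in P) (f x)%:E < +oo.

Definition sparse_coef (nu g : T -> R) (P : set T) : R :=
  fine (\int[lebesgue]_(x in P) (nu x)%:E) / fine (lebesgue P) *
  (fine (\int[lebesgue]_(x in P) (g x)%:E) / fine (lebesgue P)).

Lemma finite_subfamily_bound :
  \int[lebesgue]_x ((\sum_(P <- X)
     sparse_coef (bloom_weight p u l) f P * \1_P x) `^ p * l x)%:E <=
  ((Lam `^ (q + p - 2) * (p * q) * K1 * K2) `^ p)%:E *
    \int[lebesgue]_x (f x `^ p * u x)%:E.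
Proof.
have p0 : (0 < p)%R by rewrite (lt_trans _ p1).
have q1 : (1 < q)%R := conj_exp_gt1 p1.
have q0 : (0 < q)%R := conj_exp_gt0 p1.
have pq : (p^-1 + q^-1 = 1)%R := conj_exp_sum p1.
have mu' : measurable_fun setT (conj_weight p u) by exact: measurable_conj_weight.
have u'0 x : (0 < conj_weight p u x)%R by exact: conj_weight_gt0.
have K1gt0 : (0 < K1)%R by rewrite -lte_fin -K1E Ap_const_gt0.
have K2gt0 : (0 < K2)%R by rewrite -lte_fin -K2E Ap_const_gt0.
have fin (x : \bar R) : 0 < x < +oo -> (0 < fine x)%R /\ x = (fine x)%:E.
  by case: x => [r||]//= /andP[]; rewrite ?lte_fin ?ltxx.
have fin0 (x : \bar R) : 0 <= x -> x < +oo -> x = (fine x)%:E.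
  by case: x.
have lebQ i : (i < N)%N -> (0 < fine (lebesgue (Q i)))%R /\
    lebesgue (Q i) = (fine (lebesgue (Q i)))%:E.
  by move=> /lebY[s s0 ->].
have APu i : (i < N)%N ->
    [/\ 0 < \int[lebesgue]_(x in Q i) (u x)%:E < +oo,
        0 < \int[lebesgue]_(x in Q i) (u x `^ (1 - q))%:E < +oo &
        (fine (\int[lebesgue]_(x in Q i) (u x `^ (1 - q))%:E) /
           fine (lebesgue (Q i)) *
         (fine (\int[lebesgue]_(x in Q i) (u x)%:E) /
           fine (lebesgue (Q i))) `^ (q - 1) <= K1)%R].
  by move=> /DY; exact: Ap_conj_integrals.
have APl i : (i < N)%N ->
    [/\ 0 < \int[lebesgue]_(x in Q i) (l x)%:E < +oo,
        0 < \int[lebesgue]_(x in Q i) (l x `^ (1 - q))%:E < +oo &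
        (fine (\int[lebesgue]_(x in Q i) (l x)%:E) /
           fine (lebesgue (Q i)) *
         (fine (\int[lebesgue]_(x in Q i) (l x `^ (1 - q))%:E) /
           fine (lebesgue (Q i))) `^ (p - 1) <= K2)%R].
  by move=> iN; have [_] := Ap_integrals hD p1 ml l0 K2E (DY iN).
have nu0 i : 0 <= \int[lebesgue]_(x in Q i) (bloom_weight p u l x)%:E.
  by apply: integral_ge0 => x _; rewrite lee_fin mulr_ge0 ?powR_ge0.
have nuoo i : (i < N)%N ->
    \int[lebesgue]_(x in Q i) (bloom_weight p u l x)%:E < +oo.
  by move=> /DY; exact: bloom_weight_lty K1E K2E _.
have nuE i : (i < N)%N ->
    \int[lebesgue]_(x in Q i) (bloom_weight p u l x)%:E =
    (fine (\int[lebesgue]_(x in Q i) (bloom_weight p u l x)%:E))%:E.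
  by move=> iN; exact: fin0 _ (nu0 i) (nuoo i iN).
have fE i : (i < N)%N -> \int[lebesgue]_(x in Q i) (f x)%:E =
    (fine (\int[lebesgue]_(x in Q i) (f x)%:E))%:E.
  move=> iN; apply: fin0; last exact: fS (SY iN).
  by apply: integral_ge0 => x _; rewrite lee_fin.
have sumE x : (\sum_(P <- X) sparse_coef (bloom_weight p u l) f P * \1_P x =
    \sum_(i < N) sparse_coef (bloom_weight p u l) f (Q i) * \1_(Q i) x)%R.
  have XY : perm_eq X Y by rewrite perm_sym perm_sort.
  by rewrite (perm_big _ XY) /= (big_nth set0) big_mkord.
rewrite (eq_integral (fun x => ((\sum_(i < N)
    sparse_coef (bloom_weight p u l) f (Q i) * \1_(Q i) x) `^ p * l x)%:E));
  last by move=> x _; rewrite sumE.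
pose I (g : T -> R) i := fine (\int[lebesgue]_(x in Q i) (g x)%:E).
apply: (@finite_sparse_bound _ _ _ lebesgue p q Lam K1 K2 N Q
  (fun i => fine (lebesgue (Q i))) (I (bloom_weight p u l))
  (I u) (I (conj_weight p u)) (I l) (I (conj_weight p l)) (I f) f u l
  p0 q0 pq Lam0 K1gt0 K2gt0 sorted_nested _ _ sorted_carleson
  mf mu ml f0 u0 l0 _ _ _ _ _ _ _ _ _ _ _ nuE fE).
- by move=> i /lebQ[].
- by move=> i /lebQ[].
- by move=> i /APu[/fin[]].
- by move=> i /APu[_ /fin[]].
- by move=> i /APl[/fin[]].
- by move=> i /APl[_ /fin[]].
- by move=> i /APu[/fin[]].
- by move=> i /APu[_ /fin[]].
- by move=> i /APl[/fin[]].
- by move=> i /APl[_ /fin[]].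
- by move=> i /APu[].
- by move=> i /APl[].
- by move=> i _; exact: fine_ge0 (nu0 i).
Qed.

End bound.
End finite_subfamily.
End sparse_families.

Section sparse_operator.
Context {R : realType} {n : nat} (D S : set (set (Rn R n))) (Lam : R).
Hypotheses (n0 : (0 < n)%N) (hD : dyadic_grid D) (SD : S `<=` D).
Hypotheses (Lam0 : 0 < Lam) (hS : Carleson D S Lam).
Local Notation T := (Rn R n).
Local Open Scope ereal_scope.
Variables (p K1 K2 : R) (u l : T -> R).
Let q := conj_exp p.
Hypotheses (p1 : (1 < p)%R).
Hypotheses (mu : measurable_fun setT u) (ml : measurable_fun setT l).
Hypotheses (u0 : forall x, (0 < u x)%R) (l0 : forall x, (0 < l x)%R).
Hypotheses (K1E : Ap_const D q (conj_weight p u) = K1%:E).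
Hypotheses (K2E : Ap_const D p l = K2%:E).
Variable nu : T -> R.
Hypothesis nuE : forall Q, D Q -> \int[lebesgue]_(x in Q) (nu x)%:E =
  \int[lebesgue]_(x in Q) (bloom_weight p u l x)%:E.
Variable f : T -> R.
Hypotheses (mf : measurable_fun setT f).
Hypothesis foo : \int[lebesgue]_x (`|f x| `^ p * u x)%:E < +oo.

Let p0 : (0 < p)%R. Proof. by rewrite (lt_trans _ p1). Qed.
Let mnf : measurable_fun setT (fun x => `|f x|%R).
Proof. exact: measurableT_comp. Qed.
Let cS : countable S.
Proof. exact: sub_countable (subset_card_le SD) (grid_countable hD). Qed.
Let mS Q : S Q -> measurable Q.
Proof. by move=> /SD; exact: grid_measurable. Qed.

Let c Q : R := sparse_coef (bloom_weight p u l) (fun x => `|f x|%R) Q.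

Let c0 Q : (0 <= c Q)%R.
Proof.
rewrite /c /sparse_coef !mulr_ge0 ?invr_ge0 ?fine_ge0//.
- by apply: integral_ge0 => x _; rewrite lee_fin mulr_ge0 ?powR_ge0.
- by apply: integral_ge0 => x _; rewrite lee_fin.
Qed.

Lemma Lp_locally_integrable Q : D Q -> lebesgue.-integrable Q (EFin \o f).
Proof.
move=> DQ; apply/integrableP; split.
  by apply: measurable_funTS; exact/measurable_EFinP.
exact: (Lp_integral_lty hD p1 mu u0 K1E mnf (fun x => normr_ge0 (f x)) foo DQ).
Qed.

(** Taking absolute values inside the averages of [f] reduces everything to a
    nonnegative function. *)
Lemma bloom_term_le x Q : S Q ->
  `|bloom_term nu f x Q| <= (c Q * \1_Q x)%:E.
Proof.
move=> /SD DQ; have [s s0 Qs] := grid_lebesgue hD DQ.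
rewrite /bloom_term abse_EFin lee_fin !normrM [`|\1_Q x|%R]ger0_norm ?indicE//.
apply: ler_wpM2r => //.
have fineZ (y : \bar R) : (fine (s^-1%:E * y) = s^-1 * fine y)%R.
  case: y => [r||]//=; first by rewrite gt0_muley ?lte_fin ?invr_gt0// mulr0.
  by rewrite gt0_muleNy ?lte_fin ?invr_gt0// mulr0.
rewrite /average Qs /= !fineZ !normrM /c /sparse_coef Qs /= nuE//.
have iF := Lp_locally_integrable DQ.
have nu'0 : 0 <= \int[lebesgue]_(x in Q) (bloom_weight p u l x)%:E.
  by apply: integral_ge0 => z _; rewrite lee_fin mulr_ge0 ?powR_ge0.
rewrite [`|s^-1|%R]ger0_norm ?invr_ge0 ?(ltW s0)// ger0_norm ?fine_ge0//.
rewrite [(s^-1 * _)%R]mulrC [(s^-1 * _)%R]mulrC.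
apply: ler_wpM2l; first by rewrite divr_ge0 ?fine_ge0 ?(ltW s0).
apply: ler_wpM2r; first by rewrite invr_ge0 (ltW s0).
exact: (le_normr_Rintegral (grid_measurable hD DQ) iF).
Qed.

Lemma sparse_abs_le x : `|bloom_sparse S nu f x|%:E <=
  \esum_(Q in S) (c Q * \1_Q x)%:E.
Proof.
apply: (@le_trans _ _ (\esum_(Q in S) `|bloom_term nu f x Q|)); last first.
  by apply: le_esum => Q; exact: bloom_term_le.
have -> : \esum_(Q in S) `|bloom_term nu f x Q| =
    \esum_(Q in S) (bloom_term nu f x)^\+ Q +
    \esum_(Q in S) (bloom_term nu f x)^\- Q.
  rewrite -esumD//; apply: eq_esum => Q _.
  by rewrite -[LHS]/((abse \o bloom_term nu f x) Q) fune_abse.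
rewrite /bloom_sparse.
have : 0 <= \esum_(Q in S) (bloom_term nu f x)^\+ Q by exact: esum_ge0.
have : 0 <= \esum_(Q in S) (bloom_term nu f x)^\- Q by exact: esum_ge0.
case: (esum _ _) => [a||]//; case: (esum _ _) => [b||]//=; rewrite ?normr0//.
by rewrite !lee_fin => a0 b0; rewrite (le_trans (ler_normB _ _))// !ger0_norm.
Qed.

Lemma measurable_bloom_sparse : measurable_fun setT (bloom_sparse S nu f).
Proof.
pose a Q := (fine (average nu Q) * fine (average f Q))%R.
have posE x : \esum_(Q in S) (bloom_term nu f x)^\+ Q =
    \esum_(Q in S) (Num.max (a Q) 0 * \1_Q x)%:E.
  apply: eq_esum => Q _; rewrite funeposE /bloom_term -/(a Q) indicE.
  by case: (x \in Q); rewrite ?mulr1 ?mulr0 ?maxxx// -EFin_max.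
have negE x : \esum_(Q in S) (bloom_term nu f x)^\- Q =
    \esum_(Q in S) (Num.max (- a Q) 0 * \1_Q x)%:E.
  apply: eq_esum => Q _; rewrite funenegE /bloom_term -/(a Q) indicE.
  by case: (x \in Q); rewrite ?mulr1 ?mulr0 ?oppe0 ?maxxx// -EFin_max.
have max0 (y : R) : (0 <= Num.max y 0)%R by rewrite le_max lexx orbT.
rewrite /bloom_sparse; under eq_fun do rewrite posE negE.
apply: measurableT_comp; first exact: fine_measurable.
apply: emeasurable_funB; apply: (measurable_esum_indic cS mS) => Q; exact: max0.
Qed.

Let C := (Lam `^ (q + p - 2) * (p * q) * K1 * K2)%R.
Let Phi := \int[lebesgue]_x (`|f x| `^ p * u x)%:E.

Let finite_bound (X : seq (set T)) : uniq X -> (forall Q, Q \in X -> S Q) ->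
  \int[lebesgue]_x ((\sum_(Q <- X) c Q * \1_Q x) `^ p * l x)%:E <=
  (C `^ p * fine Phi)%:E.
Proof.
move=> uX XS.
have Phi0 : 0 <= Phi.
  by apply: integral_ge0 => x _; rewrite lee_fin mulr_ge0 ?powR_ge0// ltW.
have PhiE : Phi = (fine Phi)%:E by rewrite fineK// ge0_fin_numE.
rewrite EFinM -PhiE.
apply: (finite_subfamily_bound n0 hD SD Lam0 hS uX XS p1 mu ml u0 l0 K1E K2E mnf).
  by [].
move=> Q /SD DQ.
exact: (Lp_integral_lty hD p1 mu u0 K1E mnf (fun x => normr_ge0 (f x)) foo DQ).
Qed.

Lemma ae_summable_bloom_term :
  {ae lebesgue, forall x, summable S (bloom_term nu f x)}.
Proof.
apply: filterS (ae_esum_fin cS mS c0 ml l0 p0 finite_bound) => x.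
apply: le_lt_trans; apply: le_esum => Q; exact: bloom_term_le.
Qed.

Lemma bloom_sparse_bound :
  \int[lebesgue]_x (`|bloom_sparse S nu f x| `^ p * l x)%:E <=
  (C `^ p)%:E * \int[lebesgue]_x (`|f x| `^ p * u x)%:E.
Proof.
have Phi0 : 0 <= Phi.
  by apply: integral_ge0 => x _; rewrite lee_fin mulr_ge0 ?powR_ge0// ltW.
have PhiE : Phi = (fine Phi)%:E by rewrite fineK// ge0_fin_numE.
rewrite -/Phi PhiE -EFinM.
exact: (esum_dominated_integral cS mS c0 ml l0 p0 finite_bound
  measurable_bloom_sparse sparse_abs_le).
Qed.

End sparse_operator.

Section weights.
Context {R : realType} {n : nat} (w : weight R n).
Local Notation T := (Rn R n).
Local Open Scope ereal_scope.

Definition positive_weight : T -> R := positive_version w.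

Lemma measurable_weight : measurable_fun setT w.
Proof. by have [] := weight_locint w. Qed.

Lemma measurable_positive_weight : measurable_fun setT positive_weight.
Proof. exact: measurable_positive_version measurable_weight. Qed.

Lemma positive_weight_gt0 x : (0 < positive_weight x)%R.
Proof. exact: positive_version_gt0. Qed.

Lemma ae_positive_weight : {ae lebesgue, forall x, positive_weight x = w x}.
Proof.
apply: filterS (weight_gt0 w) => x wx.
by rewrite /positive_weight /positive_version wx.
Qed.

Lemma integral_wmeasure (f : T -> R) : measurable_fun setT f ->
  (forall x, 0 <= f x)%R ->
  \int[wmeasure w]_x (f x)%:E = \int[lebesgue]_x (f x * positive_weight x)%:E.
Proof.
apply: (integral_density measurable_positive_weight
  (fun x => ltW (positive_weight_gt0 x))) => A mA; apply/esym.
exact: (integral_ae_eq mA measurable_positive_weight measurable_weight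
  ae_positive_weight).
Qed.

Lemma poweR_Lnorm_wmeasure (p : R) (f : T -> R) : p != 0%R ->
  measurable_fun setT f ->
  'N[wmeasure w]_p%:E[EFin \o f] `^ p =
  \int[lebesgue]_x (`|f x| `^ p * positive_weight x)%:E.
Proof.
move=> p0 mf; rewrite poweR_Lnorm//; apply: integral_wmeasure.
  apply: measurableT_comp (measurable_powR _) _.
  exact: measurableT_comp.
by move=> x; exact: powR_ge0.
Qed.

Lemma Lfun_wmeasure (p : R) (f : T -> R) : p != 0%R ->
  f \in Lfun (wmeasure w) p%:E <-> measurable_fun setT f /\
    \int[lebesgue]_x (`|f x| `^ p * positive_weight x)%:E < +oo.
Proof.
move=> p0; split=> [/andP[]|[mf]].
  rewrite inE /= => mf; rewrite inE /= /finite_norm => foo.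
  split; first exact: mf.
  rewrite -(poweR_Lnorm_wmeasure p0 mf); exact: poweR_lty.
rewrite -(poweR_Lnorm_wmeasure p0 mf) => foo; apply/andP; split.
  rewrite inE; exact: mf.
rewrite inE /= /finite_norm; exact: lty_poweRy foo.
Qed.

End weights.

Lemma measurable_bloom_weight {R : realType} {n : nat} (p : R)
    (u l : Rn R n -> R) : measurable_fun setT u -> measurable_fun setT l ->
  measurable_fun setT (bloom_weight p u l).
Proof.
move=> mu ml; apply: measurable_funM.
- exact: measurableT_comp (measurable_powR _) mu.
- exact: measurableT_comp (measurable_powR _) ml.
Qed.

Unset Implicit Arguments.

Theorem theorem2p6 (R : realType) (n : nat) (hn : (0 < n)%N)
    (D : set (set (Rn R n))) (hD : dyadic_grid D)
    (S : set (set (Rn R n))) (hSD : S `<=` D)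
    (Lam : R) (hLam : 1 < Lam) (hS : Carleson D S Lam)
    (p : R) (hp : 1 < p)
    (mu lam : weight R n) (hmu : Ap D p mu) (hlam : Ap D p lam) :
  let p' := conj_exp p in
  let nu := bloom_weight p mu lam in
  let A := bloom_sparse S nu in
  [/\ (* A is well defined and maps L^p(mu) to L^p(lam) *)
      forall Q, S Q -> lebesgue.-integrable Q (EFin \o nu),
      forall f, f \in Lfun (wmeasure mu) p%:E ->
        [/\ forall Q, S Q -> lebesgue.-integrable Q (EFin \o f),
            {ae lebesgue, forall x, summable S (bloom_term nu f x)}
          & A f \in Lfun (wmeasure lam) p%:E],
      (* the norm bound, in its two forms *)
      (opnorm (wmeasure mu) (wmeasure lam) p%:E A
        <= (Lam `^ (p' + p - 2) * (p * p'))%:E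
           * Ap_const D p' (conj_weight p mu) * Ap_const D p lam)%E
    & ((Lam `^ (p' + p - 2) * (p * p'))%:E
         * Ap_const D p' (conj_weight p mu) * Ap_const D p lam
       = (Lam `^ (p' + p - 2) * (p * p'))%:E
         * Ap_const D p mu `^ (p - 1)^-1 * Ap_const D p lam)%E].
Proof.
move=> p' nu A.
have Lam0 : 0 < Lam by rewrite (lt_trans _ hLam).
have p0 : 0 < p by rewrite (lt_trans _ hp).
have pn0 : p != 0 by rewrite gt_eqF.
have mmu := measurable_weight mu; have mlam := measurable_weight lam.
pose u := positive_weight mu; pose l := positive_weight lam.
have mu_ : measurable_fun setT u := measurable_positive_weight mu.
have ml : measurable_fun setT l := measurable_positive_weight lam.
have u0 : forall x, 0 < u x := positive_weight_gt0 mu.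
have l0 : forall x, 0 < l x := positive_weight_gt0 lam.
have uE : {ae lebesgue, forall x, u x = mu x} := ae_positive_weight mu.
have lE : {ae lebesgue, forall x, l x = lam x} := ae_positive_weight lam.
have AmuE : Ap_const D p u = Ap_const D p mu := Ap_const_ae_eq hD p mu_ mmu uE.
have AlamE : Ap_const D p l = Ap_const D p lam := Ap_const_ae_eq hD p ml mlam lE.
have AconjE : Ap_const D p' (conj_weight p u) = Ap_const D p' (conj_weight p mu).
  apply: (Ap_const_ae_eq hD p' (measurable_conj_weight p mu_)
    (measurable_conj_weight p mmu)).
  by apply: filterS uE => x ux; rewrite /conj_weight ux.
have dual : (Ap_const D p' (conj_weight p u) =
    Ap_const D p u `^ (p - 1)^-1)%E := Ap_const_conj hD hp u0.
have [K2 K20 K2E] : exists2 K2, 0 < K2 & Ap_const D p l = K2%:E%E.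
  apply: (ereal_pos_real (Ap_const_gt0 hD hp ml l0)).
  rewrite AlamE; exact: hlam.
have [K1 K10 K1E] : exists2 K1, 0 < K1 &
    Ap_const D p' (conj_weight p u) = K1%:E%E.
  apply: (ereal_pos_real (Ap_const_gt0 hD (conj_exp_gt1 hp)
    (measurable_conj_weight p mu_) (fun x => conj_weight_gt0 p (u0 x)))).
  rewrite dual AmuE; exact: (poweR_lty _ hmu).
have mnu : measurable_fun setT nu by exact: measurable_bloom_weight.
have mnu' : measurable_fun setT (bloom_weight p u l).
  exact: measurable_bloom_weight.
have nuE Q : D Q -> (\int[lebesgue]_(x in Q) (nu x)%:E =
    \int[lebesgue]_(x in Q) (bloom_weight p u l x)%:E)%E.
  move=> DQ; apply: (integral_ae_eq (grid_measurable hD DQ) mnu mnu').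
  by apply: filterS2 uE lE => x ux lx; rewrite /nu /bloom_weight ux lx.
pose C := Lam `^ (p' + p - 2) * (p * p') * K1 * K2.
have CE : ((Lam `^ (p' + p - 2) * (p * p'))%:E
    * Ap_const D p' (conj_weight p mu) * Ap_const D p lam)%E = C%:E.
  by rewrite -AconjE K1E -AlamE K2E -!EFinM.
have C0 : 0 <= C.
  exact: (mulr_ge0 (mulr_ge0 (mulr_ge0 (powR_ge0 _ _)
    (mulr_ge0 (ltW p0) (ltW (conj_exp_gt0 hp)))) (ltW K10)) (ltW K20)).
have bound f : f \in Lfun (wmeasure mu) p%:E ->
    A f \in Lfun (wmeasure lam) p%:E /\
    ('N[wmeasure lam]_p%:E[EFin \o A f] `^ p <=
    (C `^ p)%:E * 'N[wmeasure mu]_p%:E[EFin \o f] `^ p)%E.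
  move=> /(Lfun_wmeasure mu f pn0)[mf foo].
  have mA : measurable_fun setT (A f) := measurable_bloom_sparse hD hSD nu f.
  have Ab := bloom_sparse_bound hn hD hSD Lam0 hS hp mu_ ml u0 l0 K1E K2E nuE
    mf foo.
  rewrite (poweR_Lnorm_wmeasure _ pn0 mA) (poweR_Lnorm_wmeasure _ pn0 mf).
  split; last exact: Ab.
  apply/(Lfun_wmeasure lam (A f) pn0); split; first exact: mA.
  apply: (le_lt_trans Ab).
  exact: (EFin_mul_lty (powR_ge0 _ _) foo).
split.
- move=> Q /hSD DQ; apply: (ge0_integrable mnu).
    by move=> x; exact: (mulr_ge0 (powR_ge0 _ _) (powR_ge0 _ _)).
  rewrite (nuE _ DQ); exact: (bloom_weight_lty hD hp mu_ ml u0 l0 K1E K2E DQ).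
- move=> f fL; have [mf foo] := (Lfun_wmeasure mu f pn0).1 fL; split.
  + move=> Q /hSD DQ.
    exact: (Lp_locally_integrable hD hp mu_ u0 K1E mf foo DQ).
  + exact: (ae_summable_bloom_term hn hD hSD Lam0 hS hp mu_ ml u0 l0 K1E K2E
      nuE mf foo).
  + exact: (bound f fL).1.
- rewrite CE; apply: ge_ereal_sup => _ [f [fL f1] <-].
  exact: (le_poweR_root p0 C0 (Lnorm_ge0 _ _ _) (Lnorm_ge0 _ _ _) f1
    (bound f fL).2).
- rewrite -AconjE dual AmuE; exact: erefl.
Qed.
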